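(* Let $\mu,\nu\in\mathcal{M}^{\infty}(G)$ and let $\mathcal{A}=(A_n)_{n\in\mathbb N}$ be a van Hove sequence in $G$ such that the twisted Eberlein convolution $[\mu,\nu]_{\mathcal A}$ exists. If $\mu$ is norm almost periodic, then $[\mu,\nu]_{\mathcal A}$ is norm almost periodic.
   Context: $G$ is a second countable, locally compact (Hausdorff) Abelian group with Haar measure $|\cdot|$. A van Hove sequence is a sequence $\mathcal A=(A_n)_{n\in\mathbb N}$ of precompact open subsets of $G$ (of positive measure) such that $\lim_{n}|\partial^K A_n|/|A_n|=0$ for each compact $K\subseteq G$, where for open $A$, $\partial^K A:=(\overline{A+K}\setminus A)\cup(((G\setminus A)-K)\cap\overline A)$. A measure on $G$ is a complex Radon measure, viewed as a linear functional on $C_c(G)$; $|\mu|$ denotes its variation measure. For a compact $K\subseteq G$ with non-empty interior let $\|\mu\|_K:=\sup_{t\in G}|\mu|(t+K)$. $\mathcal M^\infty(G)$ is the set of translation bounded measures, i.e. those with $\|\mu\|_K<\infty$ for every such $K$. For $g$ on $G$ put $\widetilde g(x)=\overline{g(-x)}$ and $(\tau_tg)(x)=g(x-t)$; for a measure, $\widetilde\mu(g)=\overline{\mu(\widetilde g)}$ and $(\tau_t\mu)(g)=\mu(\tau_{-t}g)$. The Eberlein convolution is $\mu\circledast_{\mathcal A}\nu:=\lim_{n\to\infty}\frac1{|A_n|}(\mu|_{A_n})*(\nu|_{-A_n})$ if this limit exists in the vague topology, and the twisted Eberlein convolution is $[\mu,\nu]_{\mathcal A}:=\mu\circledast_{\mathcal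 A}\widetilde\nu$ if it exists. A measure $\mu$ is norm almost periodic if, for a fixed compact $K\subseteq G$ with non-empty interior (the notion does not depend on $K$ for translation bounded measures) and all $\varepsilon>0$, the set $\{t\in G:\|\mu-\tau_t\mu\|_K<\varepsilon\}$ is relatively dense in $G$. *)

(* Defs.v *)
From HB Require Import structures.
From mathcomp Require Import all_boot all_order all_algebra.
From mathcomp Require Import all_classical all_reals all_analysis.
From mathcomp Require Export complex.

Set Implicit Arguments.
Unset Strict Implicit.
Unset Printing Implicit Defensive.

Import Order.TTheory GRing.Theory Num.Theory.
Import numFieldNormedType.Exports.

Local Open Scope classical_set_scope.
Local Open Scope complex_scope.
Local Open Scope ring_scope.

(* G with its Borel sigma-algebra. The library attaches sigma-algebras to pointed
   types only; the point plays no role. *)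
Definition borel (G : topologicalZmodType) : Type := G.

HB.instance Definition _ (G : topologicalZmodType) := Choice.copy (borel G) G.
HB.instance Definition _ (G : topologicalZmodType) :=
  isPointed.Build (borel G) (0 : G).
HB.instance Definition _ (G : topologicalZmodType) :=
  @isMeasurable.Build (sigma_display (@open G)) (borel G) <<s @open G>>
    (@sigma_algebra0 _ setT (@open G)) (@sigma_algebraC (borel G) (@open G))
    (@sigma_algebra_bigcup _ setT (@open G)).

Section Measures.
Variables (R : realType) (G : topologicalZmodType).

Definition radon (m : {measure set (borel G) -> \bar R}) : Prop :=
  [/\ forall K : set G, compact K -> (m K < +oo)%E,
      forall B : set (borel G), measurable B ->
        m B = ereal_inf [set m U | U in [set U : set G | open U /\ B `<=` U]]
    & forall U : set G, open U ->
        m U = ereal_sup [set m K | K in [set K : set G | compact K /\ K `<=` U]]].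

Definition haar_measure (m : {measure set (borel G) -> \bar R}) : Prop :=
  [/\ radon m, (0 < m [set: G])%E &
      forall (t : G) (B : set (borel G)), measurable B ->
        m [set t + x | x in B] = m B].

(* A complex Radon measure, as a combination m1 - m2 + i (m3 - m4) of positive
   Radon measures. The four parts need not be minimal: different records may
   denote the same measure, and everything below depends only on the functional
   [crm_integral]. *)
Record complex_radon := ComplexRadon {
  re_pos : {measure set (borel G) -> \bar R};
  re_neg : {measure set (borel G) -> \bar R};
  im_pos : {measure set (borel G) -> \bar R};
  im_neg : {measure set (borel G) -> \bar R};
  radon_re_pos : radon re_pos;
  radon_re_neg : radon re_neg;
  radon_im_pos : radon im_pos;
  radon_im_neg : radon im_neg }.

(* Measures act as functionals on functions G -> C. The values that matter are
   those at continuous functions of compact support and, in order to restrict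
   measures to sets and to measure sets, at bounded Borel functions of compact
   support; elsewhere the value is unspecified. *)
Definition functional := (G -> R[i]) -> R[i].

Definition cintegral (m : {measure set (borel G) -> \bar R}) : functional :=
  fun f => (\int[m]_x complex.Re (f x)) +i* (\int[m]_x complex.Im (f x)).

Definition crm_integral (mu : complex_radon) : functional := fun f =>
  cintegral (re_pos mu) f - cintegral (re_neg mu) f
  + 'i%C * (cintegral (im_pos mu) f - cintegral (im_neg mu) f).

Definition Cc (f : G -> R[i]) : Prop :=
  continuous (f : G -> R[i]^o) /\ compact (closure [set x | f x != 0]).

Implicit Types (mu nu eta : functional) (f g : G -> R[i]) (t : G) (A K : set G).

Definition translate_fun t g : G -> R[i] := fun x => g (x - t).
Definition translate t mu : functional := fun g => mu (translate_fun (- t) g).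

Definition tilde_fun g : G -> R[i] := fun x => conjc (g (- x)).
Definition tilde mu : functional := fun g => conjc (mu (tilde_fun g)).

Definition cindic A : G -> R[i] := fun x => (\1_A x)%:C.

Definition restriction mu A : functional := fun f =>
  mu (fun x => cindic A x * f x).

Definition convolution mu nu : functional := fun f =>
  mu (fun x => nu (fun y => f (x + y))).

(* |mu|(B), the supremum over the finite Borel partitions of B; used for
   precompact B only. *)
Definition variation_measure mu (B : set (borel G)) : \bar R :=
  ereal_sup [set v | exists (n : nat) (E : 'I_n -> set (borel G)),
    [/\ forall i, measurable (E i), trivIset [set: 'I_n] E,
        \bigcup_i E i = B &
        v = (\sum_(i < n) Normc.normc (mu (cindic (E i))))%:E]].

Definition norm_on K mu : \bar R :=
  ereal_sup [set variation_measure mu [set t + x | x in K] | t in [set: G]].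

Definition translation_bounded mu : Prop :=
  forall K, compact K -> K° !=set0 -> (norm_on K mu < +oo)%E.

Definition relatively_dense (S : set G) : Prop :=
  exists2 K, compact K & [set s + k | s in S & k in K] = [set: G].

Definition norm_almost_periodic K mu : Prop :=
  forall e : R, 0 < e ->
    relatively_dense
      [set t | (norm_on K (fun f => mu f - translate t mu f)%R < e%:E)%E].

Definition van_hove_boundary K A : set G :=
  (closure [set a + k | a in A & k in K] `\` A)
  `|` ([set x - k | x in ~` A & k in K] `&` closure A).

Definition van_hove (haar : {measure set (borel G) -> \bar R})
    (A : nat -> set G) : Prop :=
  (forall n, [/\ open (A n), precompact (A n) & (0 < haar (A n))%E]) /\
  (* both measures are finite, A n being precompact *)
  (forall K, compact K ->
    (fun n => fine (haar (van_hove_boundary K (A n))) / fine (haar (A n)))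
      @ \oo --> (0 : R)).

(* eta is the vague limit defining the Eberlein convolution of mu and nu. *)
Definition is_eberlein (haar : {measure set (borel G) -> \bar R})
    (A : nat -> set G) mu nu eta : Prop :=
  forall f, Cc f ->
    (fun n => ((fine (haar (A n)))%:C^-1 *
        convolution (restriction mu (A n))
                    (restriction nu [set - x | x in A n]) f) : R[i]^o)
      @ \oo --> (eta f : R[i]^o).

Definition is_twisted_eberlein (haar : {measure set (borel G) -> \bar R})
    (A : nat -> set G) mu nu eta : Prop :=
  is_eberlein haar A mu (tilde nu) eta.

End Measures.

Coercion crm_integral : complex_radon >-> functional.

(* Main.v *)
From HB Require Import structures.
Require Import Defs.
From mathcomp Require Import all_boot all_order all_algebra.
From mathcomp Require Import finmap.
From mathcomp Require Import all_classical all_reals all_analysis.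
From mathcomp Require Import measurable_realfun.
From mathcomp Require Import ring lra.

Set Implicit Arguments.
Unset Strict Implicit.
Unset Printing Implicit Defensive.

Import Order.TTheory GRing.Theory Num.Theory.
Import numFieldNormedType.Exports.

Local Open Scope classical_set_scope.
Local Open Scope complex_scope.
Local Open Scope ring_scope.

(* For a compact [H] with [K] in its interior, the norm over [K] of
   [eta - tau_t eta] is at most a constant, independent of [t], times that of
   [mu - tau_t mu]. With [rho] the twisted [nu] restricted to [- A n],
   [f] continuous supported in [H] and [Phi x := rho (f (x + .))], the
   approximants of [(eta - tau_t eta) f] are
   [(mu - tau_t mu) Phi] up to two integrals of [mu] over the complement of [A n].
   Exchanging integrals, the main term is
   [rho (y |-> (mu - tau_t mu) (f (. + y)))], of order
   [||mu - tau_t mu|| |nu|(A n)], and packing disjoint translates of [A 0] shows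
   [|nu|(A n) = O(|A n|)]. The error terms only see the part of [nu] on a van
   Hove boundary, so they are [o(|A n|)] by the same packing bound. The passage
   from continuous functions to Borel partitions is Lusin's theorem for [eta].

   Measures are handled as functionals, linear and locally bounded on bounded
   Borel functions of compact support. No variation measure is integrated
   against and no product measure is formed. *)

(** * Compactness and separation in locally compact abelian groups *)

Section TopologicalGroup.
Variable G : topologicalZmodType.
Implicit Types (A B : set G) (t x y : G).

Lemma translate_continuous t : continuous (fun x : G => x + t).
Proof.
move=> x; apply: (@continuous_comp _ _ _ (fun x => (x, t)) (fun z : G * G => z.1 + z.2)).
  by apply: cvg_pair; [exact: cvg_id|exact: cvg_cst].
exact: add_continuous.
Qed.

Lemma translatel_continuous t : continuous (fun x : G => t + x).
Proof.
have -> : (fun x : G => t + x) = fun x => x + t by apply/funext => x; rewrite addrC.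
exact: translate_continuous.
Qed.

Lemma compact_oppr A : compact A -> compact [set - x | x in A].
Proof.
move=> cA; apply: continuous_compact => //.
by apply: continuous_subspaceT => x; exact: opp_continuous.
Qed.

Lemma compact_translate t A : compact A -> compact [set t + x | x in A].
Proof.
move=> cA; apply: continuous_compact => //.
by apply: continuous_subspaceT => x; exact: translatel_continuous.
Qed.

(** Near-covering compactness, used twice: for fixed [a] the compactness of [B] gives a
    neighbourhood of [a] that serves all [b] at once, and the compactness of [A] then makes this
    uniform in [a]. *)
Lemma compact_add A B : compact A -> compact B ->
  compact [set a + b | a in A & b in B].
Proof.
move=> /compact_near_coveringP cA /compact_near_coveringP cB.
apply/compact_near_coveringP => I F P FF PAB.
have hA : forall a, A a -> \forall a' \near a & i \near F, forall b, B b -> P i (a' + b).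
  move=> a Aa.
  have := cB (G * I)%type (filter_prod (nbhs a) F) (fun ai b => P ai.2 (ai.1 + b)) _.
  apply => b Bb.
  have [[U V] /= [nU nV] UV] := PAB _ (ex_intro2 _ _ a Aa (ex_intro2 _ _ b Bb erefl)).
  have [[U1 U2] /= [nU1 nU2] U12] := add_continuous (a, b) U nU.
  exists (U2, U1 `*` V).
    by split => //=; exists (U1, V).
  move=> [b' [a' i]] /= [U2b [U1a Vi]].
  by apply: (UV (a' + b', i)); split => //=; exact: (U12 (a', b')).
have := cA I F (fun i a => forall b, B b -> P i (a + b)) FF hA.
apply: filterS => i Pi _ [a Aa [b Bb <-]]; exact: Pi.
Qed.

Lemma compact_sub A B : compact A -> compact B ->
  compact [set a - b | a in A & b in B].
Proof.
move=> cA cB.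
have -> : [set a - b | a in A & b in B] =
    [set a + b | a in A & b in [set - x | x in B]].
  apply/seteqP; split => [_ [a Aa [b Bb <-]]|_ [a Aa [_ [b Bb <-]] <-]].
    by exists a => //; exists (- b) => //; exists b.
  by exists a => //; exists b.
exact: compact_add (compact_oppr cB).
Qed.

(* A point outside [A - B] has a neighbourhood missing [A - B], by the tube lemma. *)
Lemma closed_sub_compact A B : closed A -> compact B ->
  closed [set a - b | a in A & b in B].
Proof.
move=> cA /compact_near_coveringP cB.
rewrite -openC openE => p np.
have := cB G (nbhs p) (fun q b => ~ A (q + b)).
have h : forall b, B b -> \forall b' \near b & q \near p, ~ A (q + b').
  move=> b Bb.
  have oA : open (~` A) by rewrite openC.
  have npb : (~` A) (p + b).
    by move=> Apb; apply: np; exists (p + b) => //; exists b => //; rewrite addrK.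
  have [[U1 U2] /= [nU1 nU2] U12] :=
    add_continuous (p, b) (~` A) (open_nbhs_nbhs (conj oA npb)).
  by exists (U2, U1) => // -[b' q] /= [? ?]; exact: (U12 (q, b')).
move=> /(_ _ h); apply: filterS => q hq [a Aa [b Bb abq]].
by apply: (hq b Bb); rewrite -abq subrK.
Qed.

Lemma open_translate t A : open A -> open [set t + x | x in A].
Proof.
move=> oA.
have -> : [set t + x | x in A] = (fun x => - t + x) @^-1` A.
  apply/seteqP; split => [_ [x Ax <-]|x Ax] /=; first by rewrite addKr.
  by exists (- t + x) => //; rewrite addNKr.
by apply: open_comp => // x _; exact: translatel_continuous.
Qed.

(** Add to [A] a compact neighbourhood of 0. *)
Lemma compact_nbhs_of_compact A : locally_compact [set: G] -> compact A ->
  exists2 B, compact B & A `<=` B°.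
Proof.
move=> lcG.
have [B n0B [cB _]] : exists2 B : set G, nbhs 0 B & compact B /\ closed B.
  have [B nB [cB clB]] := lcG (0 : G) I.
  have nB' : nbhs (0 : G) [set x | [set: G] x -> B x] := nB.
  by exists B => //; apply: filterS nB' => x; apply.
move=> cA; exists [set a + b | a in A & b in B]; first exact: compact_add.
move=> a Aa; rewrite /interior /=.
have : nbhs a [set x | B (x - a)].
  by have /(_ B) := @translate_continuous (- a) a; rewrite subrr; exact.
by apply: filterS => x /= Bx; exists a => //; exists (x - a) => //; rewrite addrC subrK.
Qed.

(** Urysohn's lemma is applied in the one-point compactification, which is compact Hausdorff and
    hence normal; the image of [A] is closed there and that of [U] is open. *)
Lemma urysohn_compact (R : realType) A (U : set G) :
  hausdorff_space G -> locally_compact [set: G] -> compact A -> open U ->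
  A `<=` U ->
  exists f : G -> R, [/\ continuous f, forall x, 0 <= f x <= 1,
    forall x, A x -> f x = 1 & forall x, ~ U x -> f x = 0].
Proof.
move=> hG lcG cA oU AU.
pose X := one_point_compactification G.
have hX : hausdorff_space X by exact: one_point_compactification_hausdorff.
have nX : normal_space X.
  by apply: compact_normal => //; exact: one_point_compactification_compact.
have cSA : @closed X (Some @` A).
  apply: compact_closed => //; apply: continuous_compact => //.
  apply: continuous_subspaceT.
  by move=> x; exact: (@one_point_compactification_some_continuous G x).
have cSU : @closed X (~` (Some @` U)).
  by apply: open_closedC; exact: one_point_compactification_open_some.
have AU0 : (~` (Some @` U)) `&` (Some @` A) = set0.
  apply/seteqP; split => // z [nUz [x Ax xz]].
  by apply: nUz; exists x => //; exact: AU.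
have /(@uniform_separatorP _ R) [f [cf f01 f0 f1]] :=
  normal_uniform_separator nX cSU cSA AU0.
exists (f \o Some); split.
- move=> x; apply: continuous_comp; last exact: cf.
  exact: (@one_point_compactification_some_continuous G x).
- by move=> x; have := f01 (f (Some x)) (ex_intro2 _ _ (Some x) I erefl); rewrite /= in_itv.
- by move=> x Ax; apply: f1; exists (Some x) => //; exists x.
- move=> x nUx; apply: f0; exists (Some x) => // -[y Uy [yx]].
  by apply: nUx; rewrite -yx.
Qed.

End TopologicalGroup.

(** * The real-valued modulus of complex numbers *)

Section ComplexNorm.
Variable R : realType.
Implicit Types (z w : R[i]) (x : R).
Local Notation normc := Normc.normc.

Lemma normcE z : `|z| = (normc z)%:C.
Proof. by rewrite normc_def; case: z. Qed.

Lemma normc_ge0 z : 0 <= normc z.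
Proof. by case: z => a b /=; exact: sqrtr_ge0. Qed.

Lemma normc_real x : normc x%:C = `|x|.
Proof. by rewrite /= expr0n /= addr0 sqrtr_sqr. Qed.

Lemma normc_conj z : normc (conjc z) = normc z.
Proof. by case: z => a b /=; rewrite sqrrN. Qed.

Lemma Re_le_normc z : `|complex.Re z| <= normc z.
Proof. by rewrite -lecR -normcE normc_ge_Re. Qed.

Lemma Im_le_normc z : `|complex.Im z| <= normc z.
Proof.
by case: z => a b /=; rewrite -[leLHS]sqrtr_sqr ler_sqrt ?addr_ge0 ?sqr_ge0// lerDr sqr_ge0.
Qed.

Lemma normc_le_ReIm z : normc z <= `|complex.Re z| + `|complex.Im z|.
Proof.
rewrite {1}(complexE z) (le_trans (le_normcD _ _))// normc_real lerD2l.
by rewrite Normc.normcM normc_real /= expr0n /= expr1n add0r sqrtr1 mul1r.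
Qed.

Lemma normcB z w : normc (z - w) <= normc z + normc w.
Proof. by rewrite (le_trans (le_normcD _ _))// normcN. Qed.

Lemma normc_distC z w : normc (z - w) = normc (w - z).
Proof. by rewrite -normcN opprB. Qed.

Lemma normc_sum (I : Type) (r : seq I) (P : pred I) (F : I -> R[i]) :
  normc (\sum_(i <- r | P i) F i) <= \sum_(i <- r | P i) normc (F i).
Proof.
elim/big_ind2 : _ => //; first by rewrite Normc.normc0.
by move=> a b c d ab cd; rewrite (le_trans (le_normcD _ _))// lerD.
Qed.

(** A positive element of [R[i]] is a positive real, so the complex and the real epsilons are the
    same. *)
Lemma cvg_normcP (T : Type) (F : set_system T) (FF : Filter F)
    (u : T -> R[i]) (l : R[i]) :
  (u @ F --> (l : R[i]^o)) <->
  (forall e : R, 0 < e -> \forall x \near F, normc (l - u x) < e).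
Proof.
have h (e : R[i]) : 0 < e -> exists2 r : R, 0 < r & e = r%:C.
  move=> e0; have /RRe_real eE : e \is Num.real by rewrite gtr0_real.
  by exists (complex.Re e) => //; rewrite -ltcR eE.
split.
  move=> ul e e0.
  have e0C : 0 < e%:C by rewrite (ltcR 0).
  have := (@cvgrPdist_lt _ (R[i]^o) _ F FF u l).1 ul _ e0C.
  by move=> ulC; near=> x; rewrite -ltcR -normcE; near: x; exact: ulC.
move=> ul; apply/(@cvgrPdist_lt _ (R[i]^o) _ F FF u l) => e /h[r r0 ->].
by near=> x; rewrite normcE ltcR; near: x; exact: ul.
Unshelve. all: by end_near. Qed.

End ComplexNorm.

(** * Bounded Borel functions of compact support *)

Section Admissible.
Variables (R : realType) (G : topologicalZmodType).
Hypothesis hG : hausdorff_space G.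
Implicit Types (f g : G -> R[i]) (A H : set G).
Local Notation normc := Normc.normc.

Lemma open_borel A : open A -> measurable (A : set (borel G)).
Proof. by move=> oA; exact: sub_sigma_algebra. Qed.

Lemma closed_borel A : closed A -> measurable (A : set (borel G)).
Proof.
move=> cA; rewrite -[A]setCK; apply: measurableC; apply: open_borel.
by rewrite openC.
Qed.

Lemma compact_borel A : compact A -> measurable (A : set (borel G)).
Proof. by move=> cA; apply: closed_borel; exact: compact_closed. Qed.

Lemma continuous_borel (f : G -> G) : continuous f ->
  measurable_fun [set: borel G] (f : borel G -> borel G).
Proof.
move=> cf; apply: (@measurability _ _ (borel G) (borel G) _ _ (@open G)) => //.
move=> _ [U oU <-]; rewrite setTI; apply: open_borel.
by apply: open_comp => // x _; exact: cf.
Qed.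

Lemma continuous_borel_real (f : G -> R) : continuous f ->
  measurable_fun [set: borel G] (f : borel G -> R).
Proof.
move=> cf; apply: (measurability _ (RGenOInfty.measurableE R)) => //.
move=> _ [_ [a ->] <-]; rewrite setTI; apply: open_borel.
by apply: open_comp => [x _|]; [exact: cf|exact: interval_open].
Qed.

(* The functions on which the value of a functional is specified. *)
Definition admissible f : Prop :=
  [/\ measurable_fun [set: borel G] (fun x : borel G => complex.Re (f x)),
      measurable_fun [set: borel G] (fun x : borel G => complex.Im (f x)),
      exists c, forall x, normc (f x) <= c &
      exists2 H, compact H & forall x, ~ H x -> f x = 0].

Lemma admissible0 : admissible (fun=> 0).
Proof.
split; [exact: measurable_cst|exact: measurable_cst| |].
- by exists 0 => x; rewrite Normc.normc0.
- by exists set0 => //; exact: compact0.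
Qed.

Lemma admissibleD f g : admissible f -> admissible g ->
  admissible (fun x => f x + g x).
Proof.
move=> [rf jf [c fc] [H cH fH]] [rg jg [d gd] [L cL gL]]; split.
- rewrite (_ : (fun x => _) = (fun x => complex.Re (f x)) \+ (fun x => complex.Re (g x))).
    exact: measurable_funD.
  by apply/funext => x /=; case: (f x) (g x) => ? ? [].
- rewrite (_ : (fun x => _) = (fun x => complex.Im (f x)) \+ (fun x => complex.Im (g x))).
    exact: measurable_funD.
  by apply/funext => x /=; case: (f x) (g x) => ? ? [].
- by exists (c + d) => x; rewrite (le_trans (le_normcD _ _))// lerD.
- exists (H `|` L); first exact: compactU.
  by move=> x /not_orP[nH nL]; rewrite fH// gL// addr0.
Qed.

Lemma admissibleM f g : admissible f ->
  measurable_fun [set: borel G] (fun x : borel G => complex.Re (g x)) ->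
  measurable_fun [set: borel G] (fun x : borel G => complex.Im (g x)) ->
  (exists c, forall x, normc (g x) <= c) ->
  admissible (fun x => g x * f x).
Proof.
move=> [rf jf [c fc] [H cH fH]] rg jg [d gd]; split.
- rewrite (_ : (fun x => _) = (fun x => complex.Re (g x) * complex.Re (f x)) \-
      (fun x => complex.Im (g x) * complex.Im (f x))).
    by apply: measurable_funB; exact: measurable_funM.
  by apply/funext => x /=; case: (f x) (g x) => ? ? [].
- rewrite (_ : (fun x => _) = (fun x => complex.Re (g x) * complex.Im (f x)) \+
      (fun x => complex.Im (g x) * complex.Re (f x))).
    by apply: measurable_funD; exact: measurable_funM.
  by apply/funext => x /=; case: (f x) (g x) => ? ? [].
- by exists (d * c) => x; rewrite Normc.normcM ler_pM ?normc_ge0.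
- by exists H => // x nH; rewrite fH ?mulr0.
Qed.

Lemma admissibleZ a f : admissible f -> admissible (fun x => a * f x).
Proof.
move=> af; apply: admissibleM => //; try exact: measurable_cst.
by exists (normc a).
Qed.

Lemma admissibleN f : admissible f -> admissible (fun x => - f x).
Proof.
move=> /(admissibleZ (-1)); congr admissible.
by apply/funext => x; rewrite mulN1r.
Qed.

Lemma admissibleB f g : admissible f -> admissible g ->
  admissible (fun x => f x - g x).
Proof. by move=> af /admissibleN; exact: admissibleD. Qed.

Lemma admissible_sum (I : Type) (r : seq I) (F : I -> G -> R[i]) :
  (forall i, admissible (F i)) -> admissible (fun x => \sum_(i <- r) F i x).
Proof.
move=> aF; elim: r => [|i r ih].
  by under eq_fun do rewrite big_nil; exact: admissible0.
by under eq_fun do rewrite big_cons; exact: admissibleD.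
Qed.

Lemma cindicE A x : cindic R A x = if x \in A then 1 else 0.
Proof. by rewrite /cindic indicE; case: (_ \in _). Qed.

Lemma normc_cindic A x : normc (cindic R A x) <= 1.
Proof. by rewrite cindicE; case: ifP; rewrite ?Normc.normc1 ?Normc.normc0. Qed.

Lemma admissible_indic A f : measurable (A : set (borel G)) -> admissible f ->
  admissible (fun x => cindic R A x * f x).
Proof.
move=> mA af; apply: admissibleM => //.
- exact: (measurable_indic mA).
- by exists 1 => x; exact: normc_cindic.
Qed.

Lemma admissible_comp f (h h' : G -> G) : continuous h -> continuous h' ->
  cancel h h' -> admissible f -> admissible (fun x => f (h x)).
Proof.
move=> ch ch' hh' [rf jf [c fc] [H cH fH]]; split.
- exact: (measurableT_comp rf (continuous_borel ch)).
- exact: (measurableT_comp jf (continuous_borel ch)).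
- by exists c.
- exists (h' @` H).
    by apply: continuous_compact => //; exact: continuous_subspaceT.
  by move=> x nH; apply: fH => Hx; apply: nH; exists (h x).
Qed.

Lemma admissible_translate f t : admissible f -> admissible (fun x => f (x + t)).
Proof.
apply: (@admissible_comp f (fun x => x + t) (fun x => x - t)).
- exact: translate_continuous.
- exact: translate_continuous.
- by move=> x; rewrite addrK.
Qed.

Lemma admissible_tilde f : admissible f -> admissible (tilde_fun f).
Proof.
move=> /(@admissible_comp f -%R -%R (@opp_continuous G) (@opp_continuous G) (@opprK G)).
move=> [rf jf [c fc] [H cH fH]]; split.
- by move: rf; congr measurable_fun; apply/funext => x; rewrite /tilde_fun; case: (f _).
- rewrite (_ : (fun x => _) = -%R \o (fun x : borel G => complex.Im (f (- x)))).
    exact: measurableT_comp.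
  by apply/funext => x; rewrite /tilde_fun /=; case: (f _).
- by exists c => x; rewrite /tilde_fun normc_conj.
- by exists H => // x /fH; rewrite /tilde_fun => ->; rewrite conjc0.
Qed.

Lemma admissible_cindic A H : measurable (A : set (borel G)) -> compact H ->
  A `<=` H -> admissible (cindic R A).
Proof.
move=> mA cH AH; split.
- exact: (measurable_indic mA).
- exact: (measurable_cst (0 : R)).
- by exists 1; exact: normc_cindic.
- by exists H => // x nH; rewrite cindicE memNset// => /AH.
Qed.

Lemma continuous_Re f : continuous (f : G -> R[i]^o) -> continuous (fun x => complex.Re (f x)).
Proof.
move=> cf x; apply/cvgrPdist_lt => e e0.
have /cvg_normcP/(_ e e0) := cf x.
by apply: filterS => y; apply: le_lt_trans; rewrite (le_trans _ (Re_le_normc _))//; case: (f x) (f y) => ? ? [].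
Qed.

Lemma continuous_Im f : continuous (f : G -> R[i]^o) -> continuous (fun x => complex.Im (f x)).
Proof.
move=> cf x; apply/cvgrPdist_lt => e e0.
have /cvg_normcP/(_ e e0) := cf x.
by apply: filterS => y; apply: le_lt_trans; rewrite (le_trans _ (Im_le_normc _))//; case: (f x) (f y) => ? ? [].
Qed.

(** Near covering along [\oo]: each point has a neighbourhood on which every large integer bounds
    [f], and compactness yields one integer for all of [H]. *)
Lemma continuous_bounded f H : continuous (f : G -> R[i]^o) -> compact H ->
  exists c, forall x, H x -> normc (f x) <= c.
Proof.
move=> cf /compact_near_coveringP cH.
have := cH nat \oo (fun n x => normc (f x) <= n%:R) _.
case.
- move=> x Hx.
  have /cvg_normcP/(_ 1 ltr01) := cf x => n1.
  have := nbhs_infty_ger (normc (f x) + 1) => n2.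
  exists ([set y | normc (f x - f y) < 1], [set n | normc (f x) + 1 <= n%:R]) => //.
  move=> [y n] /= [fxy]; apply: le_trans; rewrite -lerBlDl.
  apply: le_trans (ltW fxy); rewrite lerBlDl normc_distC.
  by rewrite (le_trans _ (le_normcD _ _))// addrC subrK.
move=> n _ /(_ n (leqnn n)) fn; exists n%:R => x Hx; exact: fn.
Qed.

Lemma continuous_admissible f H : continuous (f : G -> R[i]^o) -> compact H ->
  (forall x, ~ H x -> f x = 0) -> admissible f.
Proof.
move=> cf cH fH; split.
- exact: (continuous_borel_real (continuous_Re cf)).
- exact: (continuous_borel_real (continuous_Im cf)).
- have [c fc] := continuous_bounded cf cH; exists (Num.max 0 c) => x.
  have [Hx|/fH->] := pselect (H x); first by rewrite le_max fc ?orbT.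
  by rewrite Normc.normc0 le_max lexx.
- by exists H.
Qed.

Lemma Cc_supp f x : ~ closure [set x | f x != 0] x -> f x = 0.
Proof.
by move=> nx; apply: contrapT => /eqP fx; apply: nx; exact: subset_closure.
Qed.

Lemma Cc_admissible f : Cc f -> admissible f.
Proof. by move=> [cf cH]; apply: continuous_admissible cf cH _ => x; exact: Cc_supp. Qed.

Lemma CcI f H : continuous (f : G -> R[i]^o) -> compact H ->
  (forall x, ~ H x -> f x = 0) -> Cc f.
Proof.
move=> cf cH fH; split => //; apply: (subclosed_compact _ cH).
  exact: closed_closure.
have /closure_id -> := compact_closed hG cH.
by apply: closureS => x /= /eqP fx; apply: contrapT => /fH.
Qed.

Lemma Cc_translate f t : Cc f -> Cc (fun x => f (x + t)).
Proof.
move=> [cf cH].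
apply: (@CcI _ [set x - t | x in closure [set x | f x != 0]]).
- move=> x; apply: (@continuous_comp G G (R[i]^o) (fun x => x + t) f x _ (cf _)).
  exact: translate_continuous.
- apply: continuous_compact => //; apply: continuous_subspaceT => x.
  exact: translate_continuous.
- by move=> x nx; apply: Cc_supp => fx; apply: nx; exists (x + t) => //; rewrite addrK.
Qed.

(** Compactness of the support gives the bound for [x] in the support. Making the neighbourhood
    symmetric covers the case where only [x + u] is in it, and otherwise both values vanish. *)
Lemma Cc_unif_continuous f (e : R) : Cc f -> 0 < e ->
  exists2 U : set G, nbhs 0 U & forall x u, U u -> normc (f (x + u) - f x) <= e.
Proof.
move=> [cf /compact_near_coveringP cL] e0.
have e20 : 0 < e / 2 by rewrite divr_gt0.
have hL : forall x, closure [set x | f x != 0] x ->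
    \forall y \near x & u \near nbhs (0 : G), normc (f (y + u) - f y) <= e.
  move=> x _.
  have /cvg_normcP/(_ _ e20) n1 := cf x.
  have [|[U1 U2] /= [nU1 nU2] U12] := add_continuous (x, 0 : G) [set y | normc (f x - f y) < e / 2].
    by rewrite /= addr0.
  exists ([set y | normc (f x - f y) < e / 2] `&` U1, U2) => /=.
    by split => //; exact: filterI.
  move=> [y u] /= [[fxy U1y] U2u].
  rewrite -(subrK (f x) (f (y + u))) -addrA (le_trans (le_normcD _ _))//.
  rewrite (splitr e) lerD//; apply: ltW; last exact: fxy.
  by rewrite normc_distC; exact: (U12 (y, u)).
have := cL G (nbhs (0 : G)) (fun u x => normc (f (x + u) - f x) <= e) (nbhs_filter _) hL.
set L := closure _ => nU.
pose U := [set u : G | L `<=` (fun x => normc (f (x + u) - f x) <= e)].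
have nUN : nbhs (0 : G) [set u | U (- u)].
  by have /(_ U) := @opp_continuous G 0; rewrite oppr0; apply; exact: nU.
exists (U `&` [set u | U (- u)]); first exact: (filterI nU nUN).
move=> x u [Uu UNu]; have [Lx|nLx] := pselect (L x); first exact: Uu.
have [Lxu|nLxu] := pselect (L (x + u)).
  by have := UNu _ Lxu; rewrite addrK normc_distC.
by rewrite !Cc_supp// subrr Normc.normc0 ltW.
Qed.

End Admissible.

(** * Locally bounded linear functionals and regularity *)

Section Functionals.
Variables (R : realType) (G : topologicalZmodType).
Hypothesis hG : hausdorff_space G.
Implicit Types (f g : G -> R[i]) (A S H : set G) (lam rho : functional R G) (M c e : R).
Local Notation normc := Normc.normc.

(* For a measure and a precompact Borel set [S] this says that the variation of [S] is at most [M]. *)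
Definition dominated lam S M : Prop := forall f c, admissible f ->
  (forall x, normc (f x) <= c) -> (forall x, ~ S x -> f x = 0) ->
  normc (lam f) <= M * c.

(** What is retained of a complex Radon measure: a class of functionals stable under restriction to
    Borel sets, translation, [tilde] and linear combinations. *)
Record locally_bounded lam : Prop := LocallyBounded {
  lbD : forall f g, admissible f -> admissible g ->
    lam (fun x => f x + g x) = lam f + lam g;
  lbZ : forall a f, admissible f -> lam (fun x => a * f x) = a * lam f;
  lb_dom : forall H, compact H -> exists2 M, 0 <= M & dominated lam H M }.

(** Inner and outer regularity of the variation at once, in the form that Lusin's theorem
    consumes. *)
Definition regular lam : Prop := forall (E : set (borel G)) H e,
  measurable E -> compact H -> E `<=` H -> 0 < e ->
  exists C U : set G, [/\ compact C, open U, C `<=` E, E `<=` U &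
    dominated lam (U `\` C) e].

Lemma sup_ge0 f c : (forall x, normc (f x) <= c) -> 0 <= c.
Proof. by move=> /(_ 0); apply: le_trans; exact: normc_ge0. Qed.

Section LocallyBounded.
Variable lam : functional R G.
Hypothesis lbl : locally_bounded lam.

Lemma lb0 : lam (fun=> 0) = 0.
Proof.
rewrite -[RHS](mul0r (lam (fun=> 0))) -(lbZ lbl)//; last exact: admissible0.
by congr lam; apply/funext => x; rewrite mul0r.
Qed.

Lemma lbN f : admissible f -> lam (fun x => - f x) = - lam f.
Proof.
move=> af; rewrite -mulN1r -(lbZ lbl)//.
by congr lam; apply/funext => x; rewrite mulN1r.
Qed.

Lemma lbB f g : admissible f -> admissible g ->
  lam (fun x => f x - g x) = lam f - lam g.
Proof.
by move=> af ag; rewrite (lbD lbl)// ?lbN//; exact: admissibleN.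
Qed.

Lemma lb_sum (I : Type) (r : seq I) (F : I -> G -> R[i]) :
  (forall i, admissible (F i)) ->
  lam (fun x => \sum_(i <- r) F i x) = \sum_(i <- r) lam (F i).
Proof.
move=> aF; elim: r => [|i r ih].
  rewrite big_nil -[RHS]lb0; congr lam.
  by apply/funext => x; rewrite big_nil.
rewrite big_cons -ih -(lbD lbl)//; last exact: admissible_sum.
by congr lam; apply/funext => x; rewrite big_cons.
Qed.

Lemma dominatedS S S' M : S `<=` S' -> dominated lam S' M -> dominated lam S M.
Proof.
by move=> SS' dS f c af fc fS; apply: dS => // x nS'; apply: fS => /SS'.
Qed.

Lemma dominated_le S M M' : M <= M' -> dominated lam S M -> dominated lam S M'.
Proof.
move=> MM' dS f c af fc fS; rewrite (le_trans (dS f c af fc fS))//.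
by rewrite ler_wpM2r//; exact: sup_ge0 fc.
Qed.

Lemma dominated_set0 : dominated lam set0 0.
Proof.
move=> f c af fc f0; rewrite mul0r.
by rewrite (_ : f = fun=> 0) ?lb0 ?Normc.normc0//; apply/funext => x; exact: f0.
Qed.

(** Cut the test function along the Borel set [S]. The set [S'] is arbitrary, as the packing
    argument requires. *)
Lemma dominatedU (S : set (borel G)) (S' : set G) M M' : measurable S ->
  dominated lam S M -> dominated lam S' M' -> dominated lam (S `|` S') (M + M').
Proof.
move=> mS dS dS' f c af fc fS.
have mSC : measurable (~` S) by exact: measurableC.
have -> : f = fun x => cindic R S x * f x + cindic R (~` S) x * f x.
  apply/funext => x; rewrite !cindicE in_setC.
  by case: (x \in S); rewrite /= ?mul1r mul0r ?addr0 ?add0r.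
have c0 := sup_ge0 fc.
have bd (B : set G) x : normc (cindic R B x * f x) <= c.
  by rewrite Normc.normcM -[leRHS]mul1r ler_pM ?normc_ge0 ?normc_cindic.
rewrite (lbD lbl); try exact: admissible_indic.
rewrite (le_trans (le_normcD _ _))// mulrDl lerD//.
- apply: dS => //; first exact: admissible_indic.
  by move=> x nSx; rewrite cindicE memNset// mul0r.
- apply: dS' => //; first exact: admissible_indic.
  move=> x nSx; rewrite cindicE; case: ifPn; rewrite ?mul0r//.
  by rewrite inE => nS; rewrite fS ?mulr0// => -[].
Qed.

Lemma dominated_bigsetU (I : Type) (r : seq I) (S : I -> set (borel G)) (M : I -> R) :
  (forall i, measurable (S i)) -> (forall i, dominated lam (S i) (M i)) ->
  dominated lam (\big[setU/set0]_(i <- r) S i) (\sum_(i <- r) M i).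
Proof.
move=> mS dS; elim: r => [|i r ih].
  by rewrite !big_nil; exact: dominated_set0.
by rewrite !big_cons; exact: dominatedU.
Qed.

End LocallyBounded.

Lemma lb_restriction lam A : measurable (A : set (borel G)) ->
  locally_bounded lam -> locally_bounded (restriction lam A).
Proof.
move=> mA [lD lZ ld]; split.
- move=> f g af ag; rewrite /restriction -lD; try exact: admissible_indic.
  by congr lam; apply/funext => x; rewrite mulrDr.
- move=> a f af; rewrite /restriction -lZ; last exact: admissible_indic.
  by congr lam; apply/funext => x; rewrite mulrCA.
- move=> H cH; have [M M0 dM] := ld H cH; exists M => // f c af fc fH.
  apply: dM; first exact: admissible_indic.
  + move=> x; rewrite Normc.normcM -[leRHS]mul1r.
    by rewrite ler_pM ?normc_ge0 ?normc_cindic.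
  + by move=> x /fH ->; rewrite mulr0.
Qed.

Lemma lb_sub lam rho : locally_bounded lam -> locally_bounded rho ->
  locally_bounded (fun f => lam f - rho f).
Proof.
move=> [lD lZ ld] [rD rZ rd]; split.
- by move=> f g af ag; rewrite lD// rD// opprD addrACA.
- by move=> a f af; rewrite lZ// rZ// mulrBr.
- move=> H cH; have [M M0 dM] := ld H cH; have [N N0 dN] := rd H cH.
  exists (M + N); first exact: addr_ge0.
  move=> f c af fc fH; rewrite (le_trans (normcB _ _))// mulrDl.
  by rewrite lerD// ?dM ?dN.
Qed.

Lemma lb_scale a lam : locally_bounded lam -> locally_bounded (fun f => a * lam f).
Proof.
move=> [lD lZ ld]; split.
- by move=> f g af ag; rewrite lD// mulrDr.
- by move=> b f af; rewrite lZ// mulrCA.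
- move=> H cH; have [M M0 dM] := ld H cH; exists (normc a * M).
    by rewrite mulr_ge0 ?normc_ge0.
  move=> f c af fc fH; rewrite Normc.normcM -mulrA ler_wpM2l ?normc_ge0//.
  exact: dM.
Qed.

Lemma lb_add lam rho : locally_bounded lam -> locally_bounded rho ->
  locally_bounded (fun f => lam f + rho f).
Proof.
move=> ll lr; have := lb_sub ll (lb_scale (-1) lr); congr locally_bounded.
by apply/funext => f; rewrite mulN1r opprK.
Qed.

Lemma lb_translate t lam : locally_bounded lam -> locally_bounded (translate t lam).
Proof.
move=> [lD lZ ld].
have at_ f : admissible f -> admissible (translate_fun (- t) f).
  by move=> af; exact: admissible_translate.
split.
- by move=> f g af ag; rewrite /translate -lD//; exact: at_.
- by move=> a f af; rewrite /translate -lZ//; exact: at_.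
- move=> H cH; have [M M0 dM] := ld _ (compact_translate (t := - t) cH).
  exists M => // f c af fc fH; apply: dM; first exact: at_.
    by move=> x; exact: fc.
  move=> x nx; apply: fH => Hx; apply: nx; exists (x - - t) => //.
  by rewrite addrC opprK addrK.
Qed.

(** The conjugation inside [tilde_fun] and the one outside cancel, so the result is linear and not
    conjugate-linear. *)
Lemma lb_tilde lam : locally_bounded lam -> locally_bounded (tilde lam).
Proof.
move=> [lD lZ ld]; split.
- move=> f g af ag; rewrite /tilde -rmorphD -lD; try exact: admissible_tilde.
  by congr (conjc (lam _)); apply/funext => x; rewrite /tilde_fun rmorphD.
- move=> a f af; rewrite /tilde -{2}(conjcK a) -rmorphM -lZ; last exact: admissible_tilde.
  by congr (conjc (lam _)); apply/funext => x; rewrite /tilde_fun rmorphM.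
- move=> H cH; have [M M0 dM] := ld _ (compact_oppr cH).
  exists M => // f c af fc fH; rewrite normc_conj; apply: dM.
  + exact: admissible_tilde.
  + by move=> x; rewrite normc_conj.
  + move=> x nx; rewrite /tilde_fun fH ?conjc0// => Hx; apply: nx.
    by exists (- x) => //; rewrite opprK.
Qed.

Lemma dominated_tilde lam S M : dominated lam S M ->
  dominated (tilde lam) [set - x | x in S] M.
Proof.
move=> dM f c af fc fH; rewrite normc_conj; apply: dM.
- exact: admissible_tilde.
- by move=> x; rewrite normc_conj.
- move=> x nx; rewrite /tilde_fun fH ?conjc0// => -[y Sy yx].
  by apply: nx; rewrite -(opprK x) -yx opprK.
Qed.

Lemma regular_scale a lam : regular lam -> regular (fun f => a * lam f).
Proof.
move=> rl E H e mE cH EH e0.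
(* The [+ 1] keeps the divisor positive when [a = 0]. *)
have a0 : 0 < normc a + 1 by rewrite ltr_wpDl ?normc_ge0.
have [C [U [cC oU CE EU dU]]] := rl E H (e / (normc a + 1)) mE cH EH (divr_gt0 e0 a0).
exists C, U; split => // f c af fc fU.
rewrite Normc.normcM (le_trans (ler_wpM2l (normc_ge0 _) (dU f c af fc fU)))//.
rewrite mulrA ler_wpM2r//; first exact: sup_ge0 fc.
rewrite mulrCA ger_pMr// ler_pdivrMr// mul1r lerDl//.
Qed.

Lemma regular_sub lam rho : regular lam -> regular rho ->
  regular (fun f => lam f - rho f).
Proof.
move=> rl rr E H e mE cH EH e0.
have e20 : 0 < e / 2 by rewrite divr_gt0.
have [C [U [cC oU CE EU dU]]] := rl E H _ mE cH EH e20.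
have [D [V [cD oV DE EV dV]]] := rr E H _ mE cH EH e20.
(* The new difference set is contained in both old ones, so each functional costs at most
   [e / 2]. *)
exists (C `|` D), (U `&` V); split.
- exact: compactU.
- exact: openI.
- by move=> x [/CE|/DE].
- by move=> x Ex; split; [exact: EU|exact: EV].
- move=> f c af fc fS; rewrite (le_trans (normcB _ _))// (splitr e) mulrDl lerD//.
  + by apply: dU => // x nUC; apply: fS => -[[Ux Vx] /not_orP[nC nD]]; apply: nUC.
  + by apply: dV => // x nUC; apply: fS => -[[Ux Vx] /not_orP[nC nD]]; apply: nUC.
Qed.

Lemma regular_add lam rho : regular lam -> regular rho ->
  regular (fun f => lam f + rho f).
Proof.
move=> rl rr; have := regular_sub rl (regular_scale (-1) rr); congr regular.
by apply/funext => f; rewrite mulN1r opprK.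
Qed.

Lemma regular_translate t lam : regular lam -> regular (translate t lam).
Proof.
move=> rl E H e mE cH EH e0.
have mE' : measurable ((fun x => x + t) @^-1` E : set (borel G)).
  rewrite -[X in measurable X]setTI.
  by apply: (continuous_borel (@translate_continuous G t)).
have EH' : (fun x => x + t) @^-1` E `<=` [set - t + x | x in H].
  by move=> x /= /EH Hx; exists (x + t) => //; rewrite addrC addrK.
have [C [U [cC oU CE EU dU]]] :=
  rl _ _ e mE' (compact_translate (t := - t) cH) EH' e0.
exists [set t + x | x in C], [set t + x | x in U]; split.
- exact: compact_translate.
- exact: open_translate.
- by move=> _ [x /CE /= Ex <-]; rewrite addrC.
- move=> x Ex; exists (x - t); last by rewrite addrC subrK.
  by apply: EU => /=; rewrite subrK.
- move=> f c af fc fU; apply: dU.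
  + exact: admissible_translate.
  + by move=> x; exact: fc.
  + move=> x nUC; apply: fU => -[[y Uy yx] nC]; apply: nUC.
    have -> : x = y by apply: (addrI t); rewrite yx opprK addrC.
    by split => // Cy; apply: nC; exists y => //; rewrite yx opprK addrC.
Qed.

End Functionals.

(** * Complex Radon measures are locally bounded and regular *)

Section RadonFunctionals.
Variables (R : realType) (G : topologicalZmodType).
Hypothesis hG : hausdorff_space G.
Local Notation normc := Normc.normc.

Section PositiveMeasure.
Variable m : {measure set (borel G) -> \bar R}.
Hypothesis mK : forall K : set G, compact K -> (m K < +oo)%E.

Lemma bounded_integrable (D : set (borel G)) (p : borel G -> R) (c : R) :
  measurable D -> (m D < +oo)%E -> measurable_fun [set: borel G] p ->
  (forall x, `|p x| <= c) -> (forall x, ~ D x -> p x = 0) ->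
  m.-integrable [set: borel G] (EFin \o p).
Proof.
move=> mD mDoo mp pc pD.
have -> : EFin \o p = (EFin \o p) \_ D.
  apply/funext => x; rewrite patchE; case: ifPn => //.
  by rewrite notin_setE => /pD /= ->.
apply/(integrable_mkcond _ mD); apply: measurable_bounded_integrable => //.
- exact: measurable_funTS.
- exists c; split; first by rewrite num_real.
  by move=> y cy x _; exact: le_trans (pc x) (ltW cy).
Qed.

Lemma normr_integral_le (D : set (borel G)) (p : borel G -> R) (c : R) :
  measurable D -> (m D < +oo)%E -> measurable_fun [set: borel G] p ->
  (forall x, `|p x| <= c) -> (forall x, ~ D x -> p x = 0) ->
  `|\int[m]_x p x| <= c * fine (m D).
Proof.
move=> mD mDoo mp pc pD.
have ip := bounded_integrable mD mDoo mp pc pD.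
have ipD : m.-integrable D (EFin \o p) by exact: integrableS ip.
have -> : \int[m]_x p x = \int[m]_(x in D) p x.
  rewrite [RHS]Rintegral_mkcond; congr Rintegral.
  apply/funext => x; rewrite patchE; case: ifPn => //.
  by rewrite notin_setE => /pD /= ->.
rewrite (le_trans (le_normr_Rintegral mD ipD))// -Rintegral_cst//.
apply: le_Rintegral => //; first exact: integrable_norm.
apply: measurable_bounded_integrable => //.
by exists `|c|; split; [rewrite num_real|move=> y cy x _; exact: ltW].
Qed.

(** The factor 2 comes from estimating real and imaginary parts separately. *)
Lemma cintegral_dominated (D : set (borel G)) (e : R) : measurable D ->
  (m D <= e%:E)%E -> dominated (cintegral m) D (2 * e).
Proof.
move=> mD mDe f c [rf jf _ _] fc fD; have c0 := sup_ge0 fc.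
have mDoo : (m D < +oo)%E by rewrite (le_lt_trans mDe)// ltry.
have fmD : fine (m D) <= e by rewrite -lee_fin fineK// ge0_fin_numE.
have h (p : borel G -> R) : measurable_fun [set: borel G] p ->
    (forall x, `|p x| <= c) -> (forall x, ~ D x -> p x = 0) ->
    `|\int[m]_x p x| <= e * c.
  move=> mp pc pD; rewrite (le_trans (normr_integral_le mD mDoo mp pc pD))//.
  by rewrite mulrC ler_wpM2r.
rewrite (le_trans (normc_le_ReIm _))// -mulrA mulr_natl mulr2n lerD//; apply: h => //.
- by move=> x; rewrite (le_trans (Re_le_normc _)).
- by move=> x /fD ->.
- by move=> x; rewrite (le_trans (Im_le_normc _)).
- by move=> x /fD ->.
Qed.

Lemma admissible_integrable (f : G -> R[i]) : admissible f ->
  m.-integrable [set: borel G] (EFin \o (fun x : borel G => complex.Re (f x))) /\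
  m.-integrable [set: borel G] (EFin \o (fun x : borel G => complex.Im (f x))).
Proof.
move=> [rf jf [c fc] [H cH fH]]; split.
- apply: (@bounded_integrable H _ c) => //; [exact: compact_borel|exact: mK| |].
  + by move=> x; rewrite (le_trans (Re_le_normc _)).
  + by move=> x /fH ->.
- apply: (@bounded_integrable H _ c) => //; [exact: compact_borel|exact: mK| |].
  + by move=> x; rewrite (le_trans (Im_le_normc _)).
  + by move=> x /fH ->.
Qed.

Lemma lb_cintegral : locally_bounded (cintegral m).
Proof.
split.
- move=> f g /admissible_integrable[rf jf] /admissible_integrable[rg jg].
  rewrite /cintegral; apply/eqP; rewrite eq_complex /= -!RintegralD//.
  by apply/andP; split; apply/eqP; apply: eq_Rintegral => x _; case: (f x) (g x) => ? ? [].
- move=> a f /admissible_integrable[rf jf].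
  have iZ (b : R) (p : borel G -> R) : m.-integrable setT (EFin \o p) ->
      m.-integrable setT (EFin \o (fun x => b * p x)).
    by move=> ip; exact: (integrableZl measurableT b ip).
  case: a => a b; rewrite /cintegral; apply/eqP; rewrite eq_complex /=.
  rewrite -!RintegralZl// -RintegralB//; [|exact: iZ|exact: iZ].
  rewrite -RintegralD//; [|exact: iZ|exact: iZ].
  by apply/andP; split; apply/eqP; apply: eq_Rintegral => x _; case: (f x).
- move=> H cH; exists (2 * fine (m H)); first by rewrite mulr_ge0// fine_ge0.
  apply: cintegral_dominated; first exact: compact_borel.
  by rewrite fineK// ge0_fin_numE// mK.
Qed.

(* Outer regularity of [E] gives [U]; that of [H `\` E] gives [C], as the
   complement in [H] of an open neighbourhood of [H `\` E]. *)
Lemma regular_cintegral :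
  (forall B : set (borel G), measurable B ->
    m B = ereal_inf [set m U | U in [set U : set G | open U /\ B `<=` U]]) ->
  regular (cintegral m).
Proof.
move=> outer E H e mE cH EH e0.
(* Two sets of measure at most [e / 4], doubled by [cintegral_dominated], add up to [e]. *)
have e40 : 0 < e / 4 by rewrite divr_gt0.
have approx (B : set (borel G)) : measurable B -> B `<=` H ->
    exists U : set G, [/\ open U, B `<=` U & (m (U `\` B) <= (e / 4)%:E)%E].
  move=> mB BH.
  have mBoo : m B \is a fin_num.
    rewrite ge0_fin_numE//; apply: le_lt_trans (mK cH).
    by apply: le_measure; rewrite ?inE//; exact: compact_borel.
  have Binf : ereal_inf [set m U | U in [set U : set G | open U /\ B `<=` U]] \is a fin_num.
    by rewrite -outer.
  have [_ [U [oU BU] <-]] := lb_ereal_inf_adherent e40 Binf.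
  rewrite -outer// => mU; exists U; split => //.
  have mUm : measurable (U : set (borel G)) by exact: open_borel.
  rewrite measureD//; last by rewrite (lt_trans mU)// -(fineK mBoo) -EFinD ltry.
  by rewrite (setIidr BU) leeBlDl// ltW.
have mH : measurable (H : set (borel G)) by exact: compact_borel.
have [U [oU EU mU]] := approx E mE EH.
have [V [oV HEV mV]] := approx (H `\` E) (measurableD mH mE) (@subDsetl _ _ _).
have mUm : measurable (U : set (borel G)) by exact: open_borel.
have mVm : measurable (V : set (borel G)) by exact: open_borel.
exists (H `&` ~` V), U; split => //.
- by apply: compact_closedI => //; exact: open_closedC.
- by move=> x [Hx nVx]; apply: contrapT => nEx; apply: nVx; exact: HEV.
- rewrite (_ : e = 2 * (e / 4 + e / 4)).
    apply: cintegral_dominated.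
      by apply: measurableD => //; apply: measurableI => //; exact: measurableC.
    rewrite EFinD (@le_trans _ _ (m ((U `\` E) `|` (V `\` (H `\` E)))))//.
      apply: le_measure; rewrite ?inE.
      + by apply: measurableD => //; apply: measurableI => //; exact: measurableC.
      + by apply: measurableU; apply: measurableD => //; exact: measurableD.
      + move=> x [Ux nHV]; have [Ex|nEx] := pselect (E x); last by left.
        right; split; last by case.
        by apply: contrapT => nV; apply: nHV; split => //; exact: EH.
    rewrite (le_trans (measureU2 _ _ _))//; [exact: measurableD| |exact: leeD].
    by apply: measurableD => //; exact: measurableD.
  by field.
Qed.

End PositiveMeasure.

Lemma lb_crm (mu : complex_radon R G) : locally_bounded mu.
Proof.
have [[f1 _ _] [f2 _ _]] := (radon_re_pos mu, radon_re_neg mu).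
have [[f3 _ _] [f4 _ _]] := (radon_im_pos mu, radon_im_neg mu).
by apply: lb_add; [|apply: lb_scale]; apply: lb_sub; exact: lb_cintegral.
Qed.

Lemma regular_crm (mu : complex_radon R G) : regular mu.
Proof.
have [[f1 o1 _] [f2 o2 _]] := (radon_re_pos mu, radon_re_neg mu).
have [[f3 o3 _] [f4 o4 _]] := (radon_im_pos mu, radon_im_neg mu).
by apply: regular_add; [|apply: regular_scale]; apply: regular_sub;
  exact: regular_cintegral.
Qed.

End RadonFunctionals.

(** Lets an estimate end with an error [k * d] for arbitrary [d], instead of fixing the accuracy in
    advance. *)
Lemma le_eps_mul (R : realType) (a b k : R) : 0 <= k ->
  (forall d, 0 < d -> a <= b + k * d) -> a <= b.
Proof.
move=> k0 h; apply/ler_addgt0Pr => e e0.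
have k1 : 0 < k + 1 by rewrite ltr_wpDl.
rewrite (le_trans (h (e / (k + 1)) (divr_gt0 e0 k1)))// lerD2l.
by rewrite mulrCA ger_pMr// ler_pdivrMr// mul1r lerDl.
Qed.

(** * Borel partitions, variation, and covers by translates *)

Section Partitions.
Variables (R : realType) (G : topologicalZmodType).
Hypothesis hG : hausdorff_space G.
Implicit Types (f g : G -> R[i]) (lam : functional R G) (M c e : R).
Local Notation normc := Normc.normc.

Section FiniteFamily.
Variables (T : finType) (E : T -> set (borel G)) (a : T -> R[i]).
Hypothesis tE : trivIset [set: T] E.

Lemma sum_cindic_in t x : E t x -> \sum_s a s * cindic R (E s) x = a t.
Proof.
move=> Etx; rewrite (bigD1 t)//= big1 ?addr0 ?cindicE ?mem_set ?mulr1//.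
move=> s /eqP st; rewrite cindicE memNset ?mulr0// => Esx.
by apply: st; apply: tE => //; exists x.
Qed.

Lemma sum_cindic_out x : ~ (\bigcup_t E t) x -> \sum_s a s * cindic R (E s) x = 0.
Proof.
move=> nE; rewrite big1// => s _; rewrite cindicE memNset ?mulr0// => Esx.
by apply: nE; exists s.
Qed.

End FiniteFamily.

(** Remove from each [F i] the earlier ones; a point of [P] then lies in the piece of least index
    among the [F i] containing it. *)
Lemma borel_disjointify n (F : 'I_n -> set (borel G)) (P : set (borel G)) :
  (forall i, measurable (F i)) -> measurable P -> P `<=` \bigcup_i F i ->
  exists E : 'I_n -> set (borel G), [/\ forall i, measurable (E i),
    trivIset [set: 'I_n] E, \bigcup_i E i = P & forall i, E i `<=` F i].
Proof.
move=> mF mP PF.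
exists (fun i => P `&` (F i `\` \bigcup_(j in [set j : 'I_n | (j < i)%N]) F j)); split.
- move=> i; apply: measurableI => //; apply: measurableD => //.
  by apply: fin_bigcup_measurable => //; exact: finite_finset.
- move=> i j _ _ [x [[_ [Fi nFi]] [_ [Fj nFj]]]]; apply/val_inj.
  by have [ij|ji|//] := ltngtP i j; [case: nFj; exists i|case: nFi; exists j].
- apply/seteqP; split => [x [i _ []]//|x Px].
  have [i0 _ Fi0] := PF x Px.
  pose p (i : 'I_n) := `[< F i x >].
  have p0 : p i0 by exact/asboolP.
  case: (arg_minnP (fun i : 'I_n => i : nat) p0) => i /asboolP Fi imin.
  exists i => //; split => //; split => // -[j /= ji Fj].
  by have := imin j (introT (asboolP _) Fj); rewrite leqNgt ji.
- by move=> i x [_ []].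
Qed.

Lemma compact_cover_translates (H U : set G) : compact H -> open U -> U 0 ->
  exists n (y : 'I_n -> G), (forall i, H (y i)) /\
    H `<=` \bigcup_i [set y i + x | x in U].
Proof.
move=> cH oU U0.
(* [G] with 0 as distinguished point, so that compactness can be read as existence of finite
   subcovers. *)
pose pG : ptopologicalType := HB.pack (G : Type) (TopologicalZmodule.on G)
  (isPointed.Build G (0 : G)).
have : @cover_compact pG H by rewrite -compact_cover.
move=> /(_ G H (fun y => [set y + x | x in U])) [].
- by move=> y _; exact: open_translate.
- by move=> y Hy; exists y => //; exists 0; rewrite ?addr0.
move=> D DH HD; exists (size (enum_fset D)), (fun i => nth 0 (enum_fset D) i); split.
  move=> i; have /DH : nth 0 (enum_fset D) i \in D by exact: mem_nth.
  by rewrite inE.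
move=> x /HD [y /= yD Uy].
have ys : (index y (enum_fset D) < size (enum_fset D))%N by rewrite index_mem.
by exists (Ordinal ys) => //=; rewrite nth_index.
Qed.

(** Partitions in [variation_measure] are indexed by ['I_n]; enumerating [T] allows the pairs of
    grid indices in [variation_dominated]. *)
Lemma variation_finType lam (S : set (borel G)) M (T : finType) (E : T -> set (borel G)) :
  (variation_measure lam S <= M%:E)%E ->
  (forall t, measurable (E t)) -> trivIset [set: T] E -> \bigcup_t E t = S ->
  \sum_t normc (lam (cindic R (E t))) <= M.
Proof.
move=> vM mE tE ES; rewrite -lee_fin; apply: le_trans vM.
apply: ereal_sup_ubound; exists #|T|, (fun i => E (enum_val i)); split => //.
- move=> i j _ _ [x Ex]; apply: enum_val_inj.
  by apply: tE => //; exists x.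
- rewrite -ES; apply/seteqP; split => [x [i _ Ei]|x [t _ Et]].
    by exists (enum_val i).
  by exists (enum_rank t) => //; rewrite enum_rankK.
- congr (_%:E); rewrite (reindex (@enum_val T T))//.
  by apply: onW_bij; exact: enum_val_bij.
Qed.

(** The index is the integer part of [(r + c) / d]. The strict inequality on [n] leaves room for
    [r = c] in a half-open cell. *)
Lemma grid_cell (c d : R) n : 0 < d -> 2 * c < n%:R * d ->
  forall r, `|r| <= c -> exists i : 'I_n, - c + i%:R * d <= r < - c + i.+1%:R * d.
Proof.
move=> d0 cn r; rewrite ler_norml => /andP[r1 r2].
have q0 : 0 <= (r + c) / d by rewrite divr_ge0 ?(ltW d0)//; lra.
have /andP[h1 h2] := truncn_itv q0.
set k := Num.truncn _ in h1 h2.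
rewrite ler_pdivlMr// in h1; rewrite ltr_pdivrMr// in h2.
have kn : (k < n)%N.
  rewrite -(ltr_nat R) -(ltr_pM2r d0); apply: le_lt_trans h1 _; lra.
exists (Ordinal kn) => /=; apply/andP; split; lra.
Qed.

Lemma admissible_cell (p : borel G -> R) (a b : R) (S : set (borel G)) :
  measurable_fun [set: borel G] p -> measurable S ->
  measurable (S `&` [set x | a <= p x < b]).
Proof.
move=> mp mS; apply: measurableI => //.
rewrite (_ : [set x | _] = p @^-1` `[a, b[); last first.
  by apply/seteqP; split => x /=; rewrite in_itv.
by rewrite -[X in measurable X]setTI; exact: mp.
Qed.

(** Cut [S] along a grid of mesh [d] in the values of [f]. The resulting step function contributes
    at most [M * c] by the definition of variation; the remainder is at most [2 * d] in modulus and
    costs [N * 2 * d], where [N] bounds [lam] on [H]. *)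
Lemma variation_dominated lam (S H : set (borel G)) M : locally_bounded lam ->
  measurable S -> compact (H : set G) -> S `<=` H ->
  (variation_measure lam S <= M%:E)%E -> dominated lam S M.
Proof.
move=> ll mS cH SH vM f c af fc fS; have c0 := sup_ge0 fc.
have [N N0 dN] := lb_dom ll cH.
apply: (@le_eps_mul _ _ _ (N * 2)); first exact: mulr_ge0.
move=> d d0.
have [rf jf _ _] := af.
pose n := (Num.truncn (2 * c / d)).+1.
have cn : 2 * c < n%:R * d by rewrite -ltr_pdivrMr// truncnS_gt.
pose cell (p : borel G -> R) (i : 'I_n) := [set x | - c + i%:R * d <= p x < - c + i.+1%:R * d].
pose E (ij : 'I_n * 'I_n) : set (borel G) :=
  (S `&` cell (fun x => complex.Re (f x)) ij.1) `&` cell (fun x => complex.Im (f x)) ij.2.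
have mE t : measurable (E t) by do 2 apply: admissible_cell => //.
have cellI p i j x : cell p i x -> cell p j x -> i = j.
  rewrite /cell /= => /andP[h1 h2] /andP[h3 h4]; apply/val_inj.
  have lt_ (k l : nat) : - c + k%:R * d < - c + l.+1%:R * d -> (k <= l)%N.
    by rewrite ltrD2l ltr_pM2r// ltr_nat.
  by apply/eqP; rewrite eqn_leq (lt_ _ _ (le_lt_trans h1 h4)) (lt_ _ _ (le_lt_trans h3 h2)).
have tE : trivIset [set: 'I_n * 'I_n] E.
  move=> [i j] [k l] _ _ [x [[[_ /= h1] h2] [[_ /= h3] h4]]].
  by rewrite (cellI _ _ _ _ h1 h3) (cellI _ _ _ _ h2 h4).
have ES : \bigcup_t E t = S.
  apply/seteqP; split => [x [t _ [[]]]//|x Sx].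
  have [i hi] := grid_cell d0 cn (le_trans (Re_le_normc (f x)) (fc x)).
  have [j hj] := grid_cell d0 cn (le_trans (Im_le_normc (f x)) (fc x)).
  by exists (i, j).
have vE := variation_finType vM mE tE ES.
(* A value of [f] on the cell. For an empty cell it is [f 0], still bounded by [c] and multiplied by
   a zero indicator. *)
pose w t := f (xget 0 (E t)).
pose h x := \sum_t w t * cindic R (E t) x.
have aE t : admissible (cindic R (E t)).
  apply: (@admissible_cindic _ _ _ H) => //; apply: subset_trans SH.
  by rewrite -ES => x Ex; exists t.
have awE t : admissible (fun x => w t * cindic R (E t) x) by exact: admissibleZ.
have ah : admissible h by exact: admissible_sum.
have fh x : normc (f x - h x) <= 2 * d.
  have [Sx|nSx] := pselect (S x); last first.
    rewrite fS// /h sum_cindic_out ?ES// subrr Normc.normc0.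
    by rewrite mulr_ge0// ltW.
  have [t _ Et] : (\bigcup_t E t) x by rewrite ES.
  rewrite /h (sum_cindic_in _ tE Et).
  have Ew : E t (xget 0 (E t)) by apply: xgetPex; exists x.
  rewrite /w; move: Et Ew; move: (xget _ _) => z.
  move=> [[_ /= /andP[h1 h2]] /andP[h3 h4]] [[_ /= /andP[h5 h6]] /andP[h7 h8]].
  rewrite (le_trans (normc_le_ReIm _))// mulr_natl mulr2n.
  rewrite -!natr1 in h2 h4 h6 h8.
  move: h1 h2 h3 h4 h5 h6 h7 h8.
  case: (f x) (f z) => xr xi [zr zi] /= h1 h2 h3 h4 h5 h6 h7 h8.
  by apply: lerD; rewrite ler_norml; apply/andP; split; lra.
have -> : f = fun x => h x + (f x - h x) by apply/funext => x; rewrite addrC subrK.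
rewrite (lbD ll)//; last exact: admissibleB.
rewrite (le_trans (le_normcD _ _))// lerD//.
  rewrite (lb_sum ll)// (le_trans (normc_sum _ _ _))//.
  rewrite (@le_trans _ _ (\sum_t normc (lam (cindic R (E t))) * c))//; last first.
    by rewrite -mulr_suml ler_wpM2r.
  apply: ler_sum => t _; rewrite (lbZ ll)// Normc.normcM mulrC.
  by rewrite ler_wpM2l ?normc_ge0// fc.
rewrite -mulrA; apply: dN => //; first exact: admissibleB.
move=> x nHx; have nSx : ~ S x by move=> /SH.
by rewrite fS// /h sum_cindic_out ?ES// subrr.
Qed.

Lemma norm_on_dominated (K : set G) lam M : locally_bounded lam -> compact K ->
  (norm_on K lam <= M%:E)%E -> forall s, dominated lam [set s + x | x in K] M.
Proof.
move=> ll cK nM s.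
have cKs := compact_translate (t := s) cK.
apply: (variation_dominated ll (compact_borel hG cKs) cKs (@subset_refl _ _)).
by apply: le_trans nM; apply: ereal_sup_ubound; exists s.
Qed.

(** [translation_bounded] speaks of compact sets with non-empty interior, so [H] is enlarged to a
    compact neighbourhood; adjoining 0 provides an interior point even when [H] is empty. *)
Lemma translation_bounded_dominated (H : set G) lam : locally_compact [set: G] ->
  locally_bounded lam -> translation_bounded lam -> compact H ->
  exists2 M, 0 <= M & forall s, dominated lam [set s + x | x in H] M.
Proof.
move=> lcG ll tb cH.
have [B cB HB] := compact_nbhs_of_compact lcG (compactU cH (@compact_set1 _ (0 : G))).
have B0 : B° !=set0 by exists 0; apply: HB; right.
have [M M0 nM] : exists2 M, 0 <= M & (norm_on B lam <= M%:E)%E.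
  have := tb B cB B0; case: (norm_on B lam) => [r _|//|_].
    by exists `|r|; rewrite ?lee_fin ?ler_norm.
  by exists 0; rewrite ?leNye.
exists M => // s; apply: dominatedS (norm_on_dominated ll cB nM (s := s)).
by move=> _ [x Hx <-]; exists x => //; apply: interior_subset; apply: HB; left.
Qed.

(** [n] translates of [K] cover [H]. Since [n] is chosen before [lam], it will be the same for all
    differences [mu - translate t mu]. *)
Lemma dominated_cover (K H : set G) : compact K -> K° !=set0 -> compact H ->
  exists n : nat, forall lam M, locally_bounded lam ->
    (forall s, dominated lam [set s + x | x in K] M) ->
    forall s, dominated lam [set s + x | x in H] (M *+ n).
Proof.
move=> cK [p Kp] cH.
(* The interior of [K] is recentred at one of its points to become a neighbourhood of 0. *)
have oU : open [set - p + x | x in K°] by apply: open_translate; exact: open_interior.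
have U0 : [set - p + x | x in K°] 0 by exists p => //; rewrite addNr.
have [n [y [_ Hy]]] := compact_cover_translates cH oU U0.
exists n => lam M ll dM s.
have -> : M *+ n = \sum_(i < n) M by rewrite sumr_const card_ord.
pose S (i : 'I_n) : set (borel G) := [set (s + y i - p) + x | x in K].
apply: (@dominatedS _ _ _ _ (\big[setU/set0]_i S i)); last first.
  apply: dominated_bigsetU => // i.
    by apply: compact_borel => //; exact: compact_translate.
  exact: dM.
move=> _ [h /Hy [i _ [z [k Kk <-] <-]] <-].
rewrite -bigcup_seq; exists i; first exact: mem_index_enum.
exists k; first exact: interior_subset.
by rewrite !addrA.
Qed.

End Partitions.

(** * Exchanging two locally bounded functionals *)

Section Fubini.
Variables (R : realType) (G : topologicalZmodType).
Hypothesis hG : hausdorff_space G.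
Hypothesis lcG : locally_compact [set: G].
Implicit Types (f g : G -> R[i]) (lam rho : functional R G) (M c e : R).
Local Notation normc := Normc.normc.

Lemma normc_le_eq (z w : R[i]) (k : R) : 0 <= k ->
  (forall d, 0 < d -> normc (z - w) <= k * d) -> z = w.
Proof.
move=> k0 h; apply/eqP; rewrite -subr_eq0; apply/eqP/Normc.eq0_normc/eqP.
rewrite eq_le normc_ge0 andbT; apply: (@le_eps_mul _ _ _ k) => // d d0.
by rewrite add0r; exact: h.
Qed.

(** The translates of [f] by all [z] in the compact neighbourhood [y + W] vanish off one compact set
    [Q], where [lam] has a bound [M]; uniform continuity of [f] makes their differences small. *)
Lemma continuous_lb_translate lam f : locally_bounded lam -> Cc f ->
  continuous ((fun y => lam (fun x => f (x + y))) : G -> R[i]^o).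
Proof.
move=> ll cf y; apply/cvg_normcP => e e0.
have [W cW W0] := compact_nbhs_of_compact lcG (@compact_set1 _ (0 : G)).
pose L := closure [set x | f x != 0].
have cL : compact L by case: cf.
pose Q := [set a - b | a in L & b in [set y + w | w in W]].
have cQ : compact Q by apply: compact_sub => //; exact: compact_translate.
have [M M0 dM] := lb_dom ll cQ.
have M1 : 0 < M + 1 by rewrite ltr_wpDl.
have d0 : 0 < e / (M + 1) by rewrite divr_gt0.
have [U nU Uf] := Cc_unif_continuous cf d0.
have nUW : nbhs (y - y) (U `&` W).
  by rewrite subrr; apply: filterI => //; exact: (W0 0).
have nz : nbhs y [set z | (U `&` W) (z - y)] := @translate_continuous G (- y) y _ nUW.
apply: filterS nz => z [Uz Wz].
rewrite normc_distC -(lbB ll); try by apply: Cc_admissible; exact: Cc_translate.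
apply: le_lt_trans (_ : M * (e / (M + 1)) < e); last first.
  by rewrite mulrCA gtr_pMr// ltr_pdivrMr// mul1r ltrDl.
apply: dM.
- by apply: admissibleB; apply: Cc_admissible; exact: Cc_translate.
- move=> x; have -> : x + z = x + y + (z - y) by rewrite -addrA [y + (_ - _)]addrC subrK.
  exact: Uf.
- move=> x nQ; rewrite !Cc_supp ?subrr// => Lx; apply: nQ.
    exists (x + y) => //; exists y; last by rewrite addrK.
    by exists 0; rewrite ?addr0//; apply: interior_subset; exact: (W0 0).
  exists (x + z) => //; exists z; last by rewrite addrK.
  by exists (z - y) => //; rewrite addrC subrK.
Qed.

(** Meant for [y |-> lam (f (. + y))], which is continuous but may have unbounded support; the
    cut-off at [P] makes it admissible. *)
Lemma admissible_cindic_continuous (P H : set (borel G)) f : measurable P ->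
  compact (H : set G) -> P `<=` H -> continuous (f : G -> R[i]^o) ->
  admissible (fun x => cindic R P x * f x).
Proof.
move=> mP cH PH cf; have [c fc] := continuous_bounded cf cH; split.
- rewrite (_ : (fun x => _) = (fun x => \1_P x * complex.Re (f x))).
    apply: measurable_funM; first exact: measurable_indic.
    exact: (continuous_borel_real (continuous_Re cf)).
  by apply/funext => x; rewrite /cindic; case: (f x) => ? ? /=; rewrite mul0r subr0.
- rewrite (_ : (fun x => _) = (fun x => \1_P x * complex.Im (f x))).
    apply: measurable_funM; first exact: measurable_indic.
    exact: (continuous_borel_real (continuous_Im cf)).
  by apply/funext => x; rewrite /cindic; case: (f x) => ? ? /=; rewrite mul0r addr0.
- exists (Num.max 0 c) => x; rewrite cindicE; case: ifPn.
    by rewrite inE mul1r le_max => /PH /fc ->; rewrite orbT.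
  by rewrite mul0r Normc.normc0 le_max lexx.
- by exists H => // x nH; rewrite cindicE memNset ?mul0r// => /PH.
Qed.

Section Exchange.
Variables (lam rho : functional R G) (P H : set (borel G)) (f : G -> R[i]).
Hypotheses (ll : locally_bounded lam) (lr : locally_bounded rho).
Hypotheses (mP : measurable P) (cH : compact (H : set G)) (PH : P `<=` H).
Hypothesis cf : Cc f.

Let L := closure [set x | f x != 0].
Let Q := [set a - b | a in L & b in H].

(** Continuity is [continuous_lb_translate] for the restriction of [rho] to [P]; the support lies in
    [Q], the difference of the supports. *)
Lemma inner_admissible : admissible (fun x => rho (fun y => cindic R P y * f (x + y))).
Proof.
have cL : compact L by case: cf.
apply: (@continuous_admissible _ _ _ Q); last 2 first.
- exact: compact_sub.
- move=> x nQ; rewrite -[RHS](lb0 lr); congr rho; apply/funext => y.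
  rewrite cindicE; case: ifPn; rewrite ?mul0r// inE mul1r => Py.
  apply: Cc_supp => Lxy; apply: nQ; exists (x + y) => //.
  by exists y; [exact: PH|rewrite addrK].
- have := continuous_lb_translate (lb_restriction mP lr) cf.
  rewrite (_ : (fun y => restriction _ _ _) = fun x => rho (fun y => cindic R P y * f (x + y)))//.
  by apply/funext => x; congr rho; apply/funext => y; rewrite addrC.
Qed.

(* Both iterated values are approximated by [\sum_i rho(E i) lam(f (. + y i))]
   for a partition of [P] into small pieces [E i] close to [y i]. *)
Lemma lb_exchange :
  lam (fun x => rho (fun y => cindic R P y * f (x + y))) =
  rho (fun y => cindic R P y * lam (fun x => f (x + y))).
Proof.
have cL : compact L by case: cf.
have cQ : compact Q by exact: compact_sub.
have [M M0 dM] := lb_dom ll cQ.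
have [N N0 dN] := lb_dom lr cH.
have aft y : admissible (fun x => f (x + y)).
  by apply: Cc_admissible; exact: Cc_translate.
have aPf x : admissible (fun y => cindic R P y * f (x + y)).
  apply: admissible_indic => //; have := aft x; congr admissible.
  by apply/funext => y; rewrite addrC.
have f0 x y : ~ Q x -> H y -> f (x + y) = 0.
  move=> nQ Hy; apply: Cc_supp => Lxy; apply: nQ.
  by exists (x + y) => //; exists y => //; rewrite addrK.
(* Each iterated value is within [M * N * d] of the common sum [S]. *)
have M2 : 0 <= 2 * (M * N) by rewrite !mulr_ge0.
apply: (normc_le_eq M2) => d d0.
have [U nU Uf] := Cc_unif_continuous cf d0.
have [n [y [Hy HU]]] :=
  compact_cover_translates cH (@open_interior _ U) nU.
have mF i : measurable ([set y i + x | x in U°] : set (borel G)).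
  by apply: open_borel; apply: open_translate; exact: open_interior.
have [E [mE tE EP EF]] := borel_disjointify mF mP (subset_trans PH HU).
have fE i z x : E i z -> normc (f (x + z) - f (x + y i)) <= d.
  move=> /EF [u /interior_subset Uu <-]; rewrite addrA; exact: Uf.
have EH i : E i `<=` H by move=> z Ez; apply: PH; rewrite -EP; exists i.
have aE i : admissible (cindic R (E i)) by exact: (admissible_cindic R (mE i) cH (EH i)).
have aEf (a : 'I_n -> R[i]) : admissible (fun z => \sum_i a i * cindic R (E i) z).
  by apply: admissible_sum => i; exact: admissibleZ.
pose S := \sum_i rho (cindic R (E i)) * lam (fun x => f (x + y i)).
(* Used twice: for [g] the function [f (x + .)], and for [g] the inner integral
   [z |-> lam (f (. + z))]. *)
have cE (g : G -> R[i]) (a : 'I_n -> R[i]) (c : R) : 0 <= c ->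
    (forall i z, E i z -> normc (g z - a i) <= c) ->
    forall z, normc (cindic R P z * g z - \sum_i a i * cindic R (E i) z) <= c.
  move=> c0 ga z; have [Pz|nPz] := pselect (P z).
    have [i _ Ei] : (\bigcup_i E i) z by rewrite EP.
    by rewrite (sum_cindic_in _ tE Ei) cindicE mem_set// mul1r; exact: ga.
  by rewrite sum_cindic_out ?EP// cindicE memNset// mul0r subrr Normc.normc0.
have cE0 (g : G -> R[i]) (a : 'I_n -> R[i]) z : ~ H z ->
    cindic R P z * g z - \sum_i a i * cindic R (E i) z = 0.
  move=> nH; have nP : ~ P z by move=> /PH.
  by rewrite sum_cindic_out ?EP// cindicE memNset// mul0r subrr.
have rho_sum (a : 'I_n -> R[i]) :
    rho (fun z => \sum_i a i * cindic R (E i) z) = \sum_i a i * rho (cindic R (E i)).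
  rewrite (lb_sum lr); first by apply: eq_bigr => i _; rewrite (lbZ lr).
  by move=> i; exact: admissibleZ.
have h1 : normc (lam (fun x => rho (fun z => cindic R P z * f (x + z))) - S) <= M * N * d.
  have -> : S = lam (fun x => \sum_i rho (cindic R (E i)) * f (x + y i)).
    rewrite (lb_sum ll); first by apply: eq_bigr => i _; rewrite (lbZ ll).
    by move=> i; exact: admissibleZ.
  have aS : admissible (fun x => \sum_i rho (cindic R (E i)) * f (x + y i)).
    by apply: admissible_sum => i; exact: admissibleZ.
  rewrite -(lbB ll)//; last exact: inner_admissible.
  have rE x : \sum_i rho (cindic R (E i)) * f (x + y i) =
      rho (fun z => \sum_i f (x + y i) * cindic R (E i) z).
    by rewrite rho_sum; apply: eq_bigr => i _; rewrite mulrC.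
  rewrite -mulrA; apply: dM.
  - by apply: admissibleB => //; exact: inner_admissible.
  - move=> x; rewrite rE -(lbB lr)//.
    apply: dN; first exact: admissibleB.
      by apply: cE; [exact: ltW|move=> i z; exact: fE].
    by move=> z; exact: (cE0 (fun z => f (x + z)) (fun i => f (x + y i))).
  - move=> x nQ; rewrite rE -(lbB lr)// -[RHS](lb0 lr); congr rho.
    apply/funext => z; rewrite [X in _ - X]big1 ?subr0.
      rewrite cindicE; case: ifPn; rewrite ?mul0r// inE => /PH Hz.
      by rewrite f0// mulr0.
    by move=> i _; rewrite f0// mul0r.
have aPl : admissible (fun z => cindic R P z * lam (fun x => f (x + z))).
  apply: (admissible_cindic_continuous mP cH PH).
  exact: (continuous_lb_translate ll cf).
have h2 : normc (rho (fun z => cindic R P z * lam (fun x => f (x + z))) - S) <= M * N * d.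
  have -> : S = rho (fun z => \sum_i lam (fun x => f (x + y i)) * cindic R (E i) z).
    by rewrite rho_sum; apply: eq_bigr => i _; rewrite mulrC.
  rewrite -(lbB lr)// mulrAC mulrC; apply: dN; first exact: admissibleB.
    apply: cE; first by rewrite mulr_ge0// ltW.
    move=> i z Ez; rewrite -(lbB ll)//; apply: dM; first exact: admissibleB.
      by move=> x; exact: fE.
    by move=> x nQ; rewrite !f0 ?subrr//; exact: EH Ez.
  by move=> z; exact: (cE0 (fun z => lam (fun x => f (x + z))) (fun i => lam (fun x => f (x + y i)))).
set a := lam _ in h1 *; set b := rho _ in h2 *.
have -> : a - b = (a - S) - (b - S) by rewrite opprB addrA subrK.
by rewrite (le_trans (normcB _ _))// -!mulrA mulr_natl mulr2n !mulrA lerD.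
Qed.

End Exchange.

End Fubini.

(** * From continuous test functions to the variation *)

Section Lusin.
Variables (R : realType) (G : topologicalZmodType).
Hypothesis hG : hausdorff_space G.
Hypothesis lcG : locally_compact [set: G].
Implicit Types (f g : G -> R[i]) (lam rho : functional R G) (M c e : R).
Local Notation normc := Normc.normc.

Lemma continuousC_real (p : G -> R) : continuous p ->
  continuous ((fun x => (p x)%:C) : G -> R[i]^o).
Proof.
move=> cp x; apply/cvg_normcP => e e0.
have /cvgrPdist_lt/(_ e e0) := cp x; apply: filterS => z.
by rewrite -rmorphB normc_real.
Qed.

(** These phases turn a sum of moduli over a partition into the value of the functional at a single
    step function. *)
Lemma polar (z : R[i]) : exists2 w : R[i], normc w <= 1 & w * z = (normc z)%:C.
Proof.
have [->|z0] := eqVneq z 0.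
  by exists 0; rewrite ?mul0r Normc.normc0.
exists ((normc z)%:C / z); last by rewrite mulfVK.
rewrite Normc.normcM Normc.normcV normc_real ger0_norm ?normc_ge0// divff//.
by apply: contra z0 => /eqP/Normc.eq0_normc->.
Qed.

(* Lusin: [lam (\sum_i w i 1_(E i))], for unimodular [w i], is close to [lam g]
   for a continuous [g] bounded by 1. With [C i <= E i <= U i] from regularity,
   normalising the sum of Urysohn functions makes [g = w i] on [C i]. *)
Lemma variation_le_Cc lam (S O H : set G) M : locally_bounded lam -> regular lam ->
  compact S -> open O -> S `<=` O -> compact H -> O `<=` H ->
  (forall g, Cc g -> (forall x, normc (g x) <= 1) -> (forall x, ~ H x -> g x = 0) ->
    normc (lam g) <= M) ->
  (variation_measure lam S <= M%:E)%E.
Proof.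
move=> ll rl cS oO SO cH OH lamM.
apply: ge_ereal_sup => _ [n [E [mE tE ES ->]]]; rewrite lee_fin.
have EO i : E i `<=` O by move=> x Ex; apply: SO; rewrite -ES; exists i.
have EH i : E i `<=` H by move=> x /EO /OH.
(* [h - g] has modulus at most 2 and lives on the [n] differences of [U i] and [C i], each dominated
   by [d]. *)
apply: (@le_eps_mul _ _ _ (n%:R * 2)); first by rewrite mulr_ge0.
move=> d d0.
have /choice[C] : forall i, exists C : set G, exists U : set G,
    [/\ compact C, open U, C `<=` E i, E i `<=` U & dominated lam (U `\` C) d].
  by move=> i; exact: rl (mE i) cH (EH i) d0.
move=> /choice[U CU].
have cC i : compact (C i) by case: (CU i).
have CE i : C i `<=` E i by case: (CU i).
have EU i : E i `<=` U i by case: (CU i).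
have CEij i j x : C j x -> E i x -> i = j.
  by move=> Cj Ei; apply: tE => //; exists x; split => //; exact: CE.
(* Away from the other [C j], so that [p i] vanishes on them, and inside [O], so that [g] vanishes
   off [H]. *)
pose V i := (U i `&` O) `\` \bigcup_(j in [set j | j != i]) C j.
have oV i : open (V i).
  apply: openI; first by apply: openI => //; case: (CU i).
  rewrite openC; apply: closed_bigcup; first exact: finite_finset.
  by move=> j _; exact: compact_closed.
have EV i : E i `<=` V i.
  move=> x Ex; split; first by split; [exact: EU|exact: (EO i)].
  by move=> [j /= /eqP ji Cj]; apply: ji; rewrite (CEij _ _ _ Cj Ex).
have /choice[p pP] : forall i, exists p : G -> R, [/\ continuous p,
    forall x, 0 <= p x <= 1, forall x, C i x -> p x = 1 & forall x, ~ V i x -> p x = 0].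
  by move=> i; apply: urysohn_compact => // x /CE /EV.
have p0 i x : 0 <= p i x by case: (pP i) => _ /(_ x)/andP[].
(* Dividing by [q] makes the sum of the [r i] at most 1 everywhere and changes nothing on the [C i],
   where a single [p i] is nonzero and equals 1. *)
pose q x := Num.max 1 (\sum_i p i x).
have q1 x : 1 <= q x by rewrite le_max lexx.
have q0 x : 0 < q x by exact: lt_le_trans (q1 x).
pose r i x := p i x / q x.
have cq : continuous q.
  move=> x; apply: continuous_max; first exact: cvg_cst.
  by apply: cvg_big => // [|i _]; [exact: add_continuous|case: (pP i) => + _ _ _; exact].
have cr i : continuous (r i).
  move=> x; apply: cvgM; first by case: (pP i) => + _ _ _; exact.
  by apply: cvgV; [rewrite gt_eqF|exact: cq].
have /choice[w wP] : forall i, exists w : R[i],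
    normc w <= 1 /\ w * lam (cindic R (E i)) = (normc (lam (cindic R (E i))))%:C.
  by move=> i; have [w] := polar (lam (cindic R (E i))); exists w.
pose g x := \sum_i w i * (r i x)%:C.
pose h x := \sum_i w i * cindic R (E i) x.
have g1 x : normc (g x) <= 1.
  rewrite (le_trans (normc_sum _ _ _))// (@le_trans _ _ (\sum_i r i x))//.
    apply: ler_sum => i _; rewrite Normc.normcM normc_real.
    rewrite ger0_norm; last by rewrite divr_ge0// ltW.
    by rewrite ler_piMl ?divr_ge0 ?(ltW (q0 _))//; case: (wP i).
  by rewrite -mulr_suml ler_pdivrMr// mul1r le_max lexx orbT.
have r0 i x : ~ V i x -> r i x = 0 by move=> nV; rewrite /r; case: (pP i) => _ _ _ -> //; rewrite mul0r.
have gH x : ~ H x -> g x = 0.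
  move=> nH; rewrite /g big1// => i _; rewrite r0 ?mulr0//.
  by move=> [[_ /OH]].
have Ccg : Cc g.
  apply: (CcI hG _ cH gH) => x.
  apply: (@cvg_big (R[i]^o : topologicalType) _ +%R) => // [|i _]; first exact: add_continuous.
  apply: (@cvgM _ _ _ _ (fun=> w i)); first exact: cvg_cst.
  exact: continuousC_real.
have aE i : admissible (cindic R (E i)) by exact: (admissible_cindic R (mE i) cH (EH i)).
have ah : admissible h by apply: admissible_sum => i; exact: admissibleZ.
have ag : admissible g by exact: Cc_admissible.
have lamh : lam h = (\sum_i normc (lam (cindic R (E i))))%:C.
  rewrite /h (lb_sum ll); last by move=> i; exact: admissibleZ.
  rewrite rmorph_sum; apply: eq_bigr => i _; rewrite (lbZ ll)//.
  by case: (wP i).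
have -> : \sum_i normc (lam (cindic R (E i))) = normc (lam h).
  by rewrite lamh normc_real ger0_norm// sumr_ge0// => i _; exact: normc_ge0.
have -> : h = fun x => g x + (h x - g x) by apply/funext => x; rewrite addrC subrK.
rewrite (lbD ll)//; last exact: admissibleB.
rewrite (le_trans (le_normcD _ _))// lerD//; first exact: lamM.
have mUC i : measurable (U i `\` C i : set (borel G)).
  apply: measurableD; first by apply: open_borel; case: (CU i).
  exact: compact_borel.
have dUC : dominated lam (\big[setU/set0]_i (U i `\` C i)) (n%:R * d).
  have -> : n%:R * d = \sum_(i < n) d by rewrite sumr_const card_ord mulr_natl.
  by apply: dominated_bigsetU => // i; case: (CU i).
rewrite mulrAC; apply: dUC; first exact: admissibleB.
- move=> x; rewrite (le_trans (normcB _ _))// mulr2n lerD//.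
  have [Sx|nSx] := pselect (S x).
    have [i _ Ei] : (\bigcup_i E i) x by rewrite ES.
    by rewrite /h (sum_cindic_in _ tE Ei); case: (wP i).
  by rewrite /h sum_cindic_out ?ES// Normc.normc0.
move=> x nUC.
have {}nUC i : ~ (U i `\` C i) x.
  by move=> UCi; apply: nUC; rewrite -bigcup_seq; exists i => //; exact: mem_index_enum.
(* Such a point lies either in some [C i], where [h] and [g] both equal [w i], or outside every
   [U i], where both vanish. *)
have [[i _ Ci]|nC] := pselect ((\bigcup_i C i) x).
  rewrite /h (sum_cindic_in _ tE (CE _ _ Ci)).
  have pj j : j != i -> p j x = 0.
    move=> ji; case: (pP j) => _ _ _; apply => -[_]; apply.
    by exists i => //=; rewrite eq_sym.
  have pi1 : p i x = 1 by case: (pP i) => _ _ /(_ _ Ci).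
  have qx : q x = 1.
    rewrite /q (bigD1 i)//= big1 ?addr0 ?pi1 ?maxxx//.
  rewrite /g (bigD1 i)//= big1 ?addr0 /r ?pi1 ?qx ?divr1 ?mulr1 ?subrr//.
  by move=> j ji; rewrite pj// mul0r mulr0.
rewrite /h sum_cindic_out; last first.
  move=> [i _ Ei]; apply: (nUC i); split; first exact: EU.
  by move=> Ci; apply: nC; exists i.
rewrite /g big1 ?subrr// => i _; rewrite r0 ?mulr0// => -[[Ui _] _].
apply: (nUC i); split => // Ci; by apply: nC; exists i.
Qed.

End Lusin.

(** * Van Hove boundaries of a precompact open set *)

Section VanHoveBoundary.
Variable G : topologicalZmodType.
Hypothesis hG : hausdorff_space G.
Variables (A : set G).
Hypotheses (oA : open A) (pA : precompact A).

Let cA : compact (closure A).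
Proof. by rewrite -precompactE. Qed.

Lemma van_hove_boundary_borel (K : set G) : compact K ->
  measurable (van_hove_boundary K A : set (borel G)).
Proof.
move=> cK; apply: measurableU.
  apply: measurableD; last exact: open_borel.
  by apply: closed_borel; exact: closed_closure.
apply: measurableI; last by apply: closed_borel; exact: closed_closure.
by apply: closed_borel; apply: closed_sub_compact => //; exact: open_closedC.
Qed.

Lemma van_hove_boundary_compact (K : set G) : compact K ->
  exists2 H, compact H & van_hove_boundary K A `<=` H.
Proof.
move=> cK; have cAK := compact_add cA cK.
exists ([set a + k | a in closure A & k in K] `|` closure A); first exact: compactU.
move=> x [[+ _]|[_ +]]; last by right.
move=> AKx; left; have /closure_id -> := compact_closed hG cAK.
apply: closureS AKx => _ [a Aa [k Kk <-]]; exists a; first exact: subset_closure.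
by exists k.
Qed.

(** A sum leaving [A] is in the outer half of the boundary. *)
Lemma add_sub_van_hove_boundary (V K : set G) (s v : G) : V `<=` K -> A s -> V v ->
  (A `|` van_hove_boundary K A) (s + v).
Proof.
move=> VK As Vv; have [Asv|nAsv] := pselect (A (s + v)); first by left.
right; left; split => //; apply: subset_closure.
by exists s => //; exists v => //; exact: VK.
Qed.

(** The two parts of the enlarged set serve the two halves of the boundary: if [s + v] stays in [A],
    it equals [z - (l - v)] with [z] outside [A]; otherwise [v] itself has carried [s] out of
    [A]. *)
Lemma inner_add_van_hove_boundary (V L : set G) (s v : G) :
  (A `&` [set x - l | x in ~` A & l in L]) s -> V v ->
  van_hove_boundary ([set l - v | l in L & v in V] `|` V) A (s + v).
Proof.
move=> [As [z nAz [l Ll zls]]] Vv; have [Asv|nAsv] := pselect (A (s + v)).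
  right; split; last exact: subset_closure.
  exists z => //; exists (l - v); first by left; exists l => //; exists v.
  by rewrite opprB addrCA -zls addrC.
left; split => //; apply: subset_closure.
by exists s => //; exists v => //; right.
Qed.

End VanHoveBoundary.

(** * Packing translates and comparing with Haar measure *)

Section HaarCount.
Variables (R : realType) (G : topologicalZmodType).
Hypothesis hG : hausdorff_space G.
Variable m : {measure set (borel G) -> \bar R}.
Hypothesis m_translate : forall (t : G) (B : set (borel G)), measurable B ->
  m [set t + x | x in B] = m B.
Implicit Types (lam : functional R G) (M : R).

(* Greedy packing: remove a translate [s + V] from [T] and [s + (V - V)] from
   [S], as long as [S] is not empty. *)
Lemma dominated_haar lam (V W S T : set G) M : locally_bounded lam -> 0 <= M ->
  open V -> (0 < m V)%E -> (m V < +oo)%E -> compact W ->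
  [set v - w | v in V & w in V] `<=` W ->
  (forall s, dominated lam [set s + x | x in W] M) ->
  measurable (T : set (borel G)) -> (m T < +oo)%E ->
  (forall s v, S s -> V v -> T (s + v)) ->
  dominated lam S (M * (fine (m T) / fine (m V))).
Proof.
move=> ll M0 oV V0 Voo cW VW dM.
have fV : m V = (fine (m V))%:E by rewrite fineK// ge0_fin_numE.
have v0 : 0 < fine (m V) by rewrite -lte_fin -fV.
(* Each round takes measure [m V] out of [T], so [n] bounds the rounds still possible; for [n = 0]
   the bound on [m T] is absurd. *)
suff h n : forall S T, measurable (T : set (borel G)) -> (m T < +oo)%E ->
    fine (m T) < n%:R * fine (m V) -> (forall s v, S s -> V v -> T (s + v)) ->
    dominated lam S (M * (fine (m T) / fine (m V))).
  move=> mT Too ST; apply: (h (Num.truncn (fine (m T) / fine (m V))).+1) => //.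
  by rewrite -ltr_pdivrMr// truncnS_gt.
elim: n => [|n ih] {}S {}T mT Too.
  by rewrite mul0r ltNge fine_ge0.
have fT : m T = (fine (m T))%:E by rewrite fineK// ge0_fin_numE.
move=> Tn ST; have [->|/set0P[s Ss]] := eqVneq S set0.
  apply: dominated_le (dominated_set0 ll).
  by rewrite mulr_ge0// divr_ge0// fine_ge0.
pose sV : set G := [set s + x | x in V].
have msV : measurable (sV : set (borel G)) by apply: open_borel; exact: open_translate.
have sVT : sV `<=` T by move=> _ [v Vv <-]; exact: ST.
have mTD : m (T `\` sV) = (fine (m T) - fine (m V))%:E.
  have -> : (fine (m T) - fine (m V))%:E = (m T - m sV)%E.
    by rewrite EFinB -fV -fT m_translate//; exact: open_borel.
  by rewrite measureD// (setIidr sVT).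
have fTD : fine (m (T `\` sV)) = fine (m T) - fine (m V) by rewrite mTD.
have -> : M * (fine (m T) / fine (m V)) =
    M + M * (fine (m (T `\` sV)) / fine (m V)).
  by rewrite fTD mulrBl divff ?gt_eqF// mulrBr mulr1 addrC subrK.
apply: (@dominatedS _ _ _ _ ([set s + x | x in W] `|` (S `\` [set s + x | x in W]))).
  by move=> x Sx; have [?|?] := pselect ([set s + x | x in W] x); [left|right].
apply: dominatedU => //.
  by apply: compact_borel => //; exact: compact_translate.
apply: ih.
- exact: measurableD.
- by rewrite mTD ltry.
- by rewrite -natr1 mulrDl mul1r in Tn; rewrite fTD ltrBlDr.
- move=> x v [Sx nW] Vv; split; first exact: ST.
  (* If [x + v] were in the removed translate, [x] would be [s + (w - v)], a point of [s + W]. *)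
  move=> [w Vw swxv]; apply: nW; exists (w - v).
    by apply: VW; exists w => //; exists v.
  by rewrite addrA swxv addrK.
Qed.

End HaarCount.

(** * Approximants of the Eberlein convolution for one set [A] *)

Section FiniteEberlein.
Variables (R : realType) (G : topologicalZmodType).
Hypothesis hG : hausdorff_space G.
Hypothesis lcG : locally_compact [set: G].
Local Notation normc := Normc.normc.
Variables (mu rho : functional R G) (A : set G).
Hypotheses (lmu : locally_bounded mu) (lrho : locally_bounded rho).
Hypotheses (oA : open A) (pA : precompact A).
Implicit Types (f : G -> R[i]) (t : G).

Let A' : set G := [set - x | x in A].
Let H' : set G := [set - x | x in closure A].

Let mA : measurable (A : set (borel G)).
Proof. exact: open_borel. Qed.

Let mA' : measurable (A' : set (borel G)).
Proof.
apply: open_borel; rewrite (_ : A' = -%R @^-1` A).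
  by apply: open_comp => // x _; exact: opp_continuous.
apply/seteqP; split => [_ [x Ax <-]|x Ax] /=; first by rewrite opprK.
by exists (- x) => //; rewrite opprK.
Qed.

Let cH' : compact H'.
Proof. by apply: compact_oppr; rewrite -precompactE. Qed.

Let AH' : A' `<=` H'.
Proof. by move=> _ [x Ax <-]; exists x => //; exact: subset_closure. Qed.

(** The function [Phi] of the outline: the inner integral of the convolution. *)
Definition smoothed f : G -> R[i] := fun x => restriction rho A' (fun y => f (x + y)).

(** The price of integrating [smoothed f] against all of [mu]. Translation commutes with [smoothed]
    but not with the restriction of [mu] to [A]. *)
Definition boundary_term f := restriction mu (~` A) (smoothed f).

Lemma admissible_smoothed f : Cc f -> admissible (smoothed f).
Proof. by move=> cf; exact: inner_admissible lrho mA' cH' AH' cf. Qed.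

Lemma smoothed_translate f t :
  smoothed (translate_fun (- t) f) = translate_fun (- t) (smoothed f).
Proof.
apply/funext => x; congr rho; apply/funext => y.
by rewrite /translate_fun addrAC.
Qed.

Lemma convolution_split f : Cc f ->
  convolution (restriction mu A) (restriction rho A') f =
  mu (smoothed f) - boundary_term f.
Proof.
move=> cf; have af := admissible_smoothed cf.
rewrite /boundary_term /convolution -(lbB lmu)//.
  congr mu; apply/funext => x; rewrite !cindicE in_setC.
  by case: (x \in A) => /=; rewrite ?mul1r ?mul0r ?subr0 ?subrr.
by apply: admissible_indic => //; exact: measurableC.
Qed.

Lemma convolution_translate_diff t f : Cc f ->
  convolution (restriction mu A) (restriction rho A') f -
  convolution (restriction mu A) (restriction rho A') (translate_fun (- t) f) =
  (mu (smoothed f) - translate t mu (smoothed f)) -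
  (boundary_term f - boundary_term (translate_fun (- t) f)).
Proof.
move=> cf; rewrite !convolution_split//; last exact: Cc_translate.
by rewrite smoothed_translate /translate; ring.
Qed.

(** After the exchange, [lam] meets the translate of [f] by [y], which vanishes off [- y + H]; its
    value is at most [e], and [rho] on [A'] contributes the factor [M]. *)
Lemma smoothed_le lam f (H : set G) (M e : R) : locally_bounded lam -> Cc f ->
  (forall x, normc (f x) <= 1) -> (forall x, ~ H x -> f x = 0) -> 0 <= e ->
  (forall s, dominated lam [set s + x | x in H] e) -> dominated rho A' M ->
  normc (lam (smoothed f)) <= M * e.
Proof.
move=> ll cf f1 fH e0 dH dA.
rewrite /smoothed /restriction (lb_exchange hG lcG ll lrho mA' cH' AH' cf).
apply: dA.
- apply: (admissible_cindic_continuous mA' cH' AH').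
  exact: (continuous_lb_translate hG lcG ll cf).
- move=> y; rewrite cindicE; case: ifPn => _; last by rewrite mul0r Normc.normc0.
  rewrite mul1r -[leRHS]mulr1; apply: (dH (- y)) => //.
    by apply: Cc_admissible; exact: Cc_translate.
  move=> x nx; apply: fH => Hxy; apply: nx; exists (x + y) => //.
  by rewrite addrC addrK.
- by move=> y nA; rewrite cindicE memNset// mul0r.
Qed.

(** After the exchange, the inner value at [y = - a] vanishes unless [x - a] is in [L] for some [x]
    outside [A]. Hence [rho] only counts points [a] of [A] of the form [x - l]. *)
Lemma boundary_term_le f (L : set G) (M N c : R) : Cc f -> 0 <= c -> 0 <= N ->
  (forall x, normc (f x) <= c) -> (forall x, ~ L x -> f x = 0) ->
  (forall s, dominated mu [set s + x | x in L] N) ->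
  dominated rho [set - s | s in A `&` [set x - l | x in ~` A & l in L]] M ->
  normc (boundary_term f) <= M * (N * c).
Proof.
move=> cf c0 N0 fc fL dL dM.
have mAC : measurable (~` A : set (borel G)) by exact: measurableC.
have lA : locally_bounded (restriction mu (~` A)) by exact: lb_restriction.
rewrite /boundary_term /smoothed /(restriction rho _).
rewrite (lb_exchange hG lcG lA lrho mA' cH' AH' cf); apply: dM.
- apply: (admissible_cindic_continuous mA' cH' AH').
  exact: (continuous_lb_translate hG lcG lA cf).
- move=> y; rewrite cindicE; case: ifPn => _; last first.
    by rewrite mul0r Normc.normc0 mulr_ge0.
  rewrite mul1r; apply: (dL (- y)).
  + by apply: admissible_indic => //; apply: Cc_admissible; exact: Cc_translate.
  + move=> x; rewrite Normc.normcM -[leRHS]mul1r.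
    by rewrite ler_pM ?normc_ge0 ?normc_cindic.
  + move=> x nx; rewrite fL ?mulr0// => Lxy; apply: nx; exists (x + y) => //.
    by rewrite addrC addrK.
- move=> y ny; rewrite cindicE; case: ifPn; rewrite ?mul0r// inE => -[a Aa ay].
  rewrite mul1r /restriction -[RHS](lb0 lmu); congr mu; apply/funext => x.
  rewrite cindicE in_setC; case: (boolP (x \in A)) => [_|nAx] /=.
    by rewrite mul0r.
  rewrite fL ?mulr0// => Lxy; apply: ny; exists a => //; split => //.
  exists x; first by rewrite notin_setE in nAx.
  by exists (x + y) => //; rewrite opprD addNKr -ay opprK.
Qed.

End FiniteEberlein.

(** * Passage to the limit along the van Hove sequence *)

Section Eberlein.
Variables (R : realType) (G : topologicalZmodType).
Hypothesis hG : hausdorff_space G.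
Hypothesis lcG : locally_compact [set: G].
Local Notation normc := Normc.normc.
Variables (haar : {measure set (borel G) -> \bar R}).
Hypothesis haarP : haar_measure haar.
Variables (mu nu eta : functional R G) (A : nat -> set G).
Hypotheses (lmu : locally_bounded mu) (lnu : locally_bounded nu).
Hypotheses (mu_bounded : translation_bounded mu) (nu_bounded : translation_bounded nu).
Hypothesis A_van_hove : van_hove haar A.
Hypothesis etaP : is_twisted_eberlein haar A mu nu eta.

Let oA n : open (A n). Proof. by have [/(_ n)[]] := A_van_hove. Qed.
Let pA n : precompact (A n). Proof. by have [/(_ n)[]] := A_van_hove. Qed.
Let A_gt0 n : (0 < haar (A n))%E. Proof. by have [/(_ n)[]] := A_van_hove. Qed.

Let haarK (K : set G) : compact K -> (haar K < +oo)%E.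
Proof. by case: haarP => -[h _ _] _ _; exact: h. Qed.

Let haarA n : (haar (A n) < +oo)%E.
Proof.
have cA : compact (closure (A n)) by rewrite -precompactE.
apply: le_lt_trans (haarK cA); apply: le_measure; rewrite ?inE.
- exact: open_borel.
- exact: compact_borel.
- exact: subset_closure.
Qed.

Let a n := fine (haar (A n)).
Let b K n := fine (haar (van_hove_boundary K (A n))).

Let a_gt0 n : 0 < a n.
Proof. by rewrite -lte_fin fineK// ge0_fin_numE. Qed.

Let haar_boundary K n : compact K -> (haar (van_hove_boundary K (A n)) < +oo)%E.
Proof.
move=> cK; have [H cH bH] := van_hove_boundary_compact hG (@pA n) cK.
apply: le_lt_trans (haarK cH); apply: le_measure; rewrite ?inE//.
- exact: van_hove_boundary_borel.
- exact: compact_borel.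
Qed.

Let V := A 0%N.
Let cV : compact (closure V). Proof. by rewrite -precompactE; exact: pA. Qed.

(* [V := A 0] is merely a nonempty open set with compact closure; it need not contain 0. *)
Lemma dominated_van_hove : exists2 k : R, 0 <= k &
  (forall n, dominated (tilde nu) [set - x | x in A n] (k * (a n + b (closure V) n))) /\
  forall L, compact L -> exists2 K, compact K & forall n,
    dominated (tilde nu)
      [set - s | s in A n `&` [set x - l | x in ~` A n & l in L]] (k * b K n).
Proof.
pose W := [set v - w | v in closure V & w in closure V].
have cW : compact W by exact: compact_sub.
have VW : [set v - w | v in V & w in V] `<=` W.
  move=> _ [v Vv [w Vw <-]]; exists v; first exact: subset_closure.
  by exists w => //; exact: subset_closure.
have [M M0 dM] := translation_bounded_dominated hG lcG lnu nu_bounded cW.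
case: (haarP) => _ _ haar_translate.
(* The packing bound for [nu], reflected to [tilde nu], with any upper bound [tt] for the measure of
   [T]. *)
have count S (T : set (borel G)) (tt : R) : measurable T -> (haar T <= tt%:E)%E ->
    (forall s v, S s -> V v -> T (s + v)) ->
    dominated (tilde nu) [set - s | s in S] (M / fine (haar V) * tt).
  move=> mT Tt ST; apply: dominated_tilde.
  have Too : (haar T < +oo)%E by rewrite (le_lt_trans Tt)// ltry.
  have := dominated_haar hG haar_translate lnu M0 (oA 0) (A_gt0 0) (haarA 0) cW VW dM mT Too ST.
  apply: dominated_le; rewrite mulrAC mulrA ler_wpM2r ?invr_ge0 ?fine_ge0//.
  by rewrite ler_wpM2l// -lee_fin fineK// ge0_fin_numE.
exists (M / fine (haar V)); first by rewrite divr_ge0// fine_ge0.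
split.
  move=> n; apply: (count _ (A n `|` van_hove_boundary (closure V) (A n))).
  - apply: measurableU; first exact: open_borel.
    exact: van_hove_boundary_borel.
  - rewrite EFinD !fineK; [|by rewrite ge0_fin_numE// haar_boundary|by rewrite ge0_fin_numE].
    apply: measureU2; first exact: open_borel.
    exact: van_hove_boundary_borel.
  - move=> s v As Vv; apply: add_sub_van_hove_boundary (@subset_closure _ V) As Vv.
move=> L cL.
pose K := [set l - v | l in L & v in closure V] `|` closure V.
have cK : compact K by apply: compactU => //; exact: compact_sub.
exists K => // n; apply: (count _ (van_hove_boundary K (A n))).
- exact: van_hove_boundary_borel.
- by rewrite fineK// ge0_fin_numE// haar_boundary.
- move=> s v Ss Vv; apply: (inner_add_van_hove_boundary Ss); exact: subset_closure.
Qed.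

(** [k] is the constant of [dominated_van_hove], chosen before [H], [t] and [f]. After division by
    [a n] the main term is at most [k * e] up to a van Hove boundary, and the boundary terms tend to
    0. *)
Lemma eberlein_translate_le : exists2 k : R, 0 <= k &
  forall (H : set G) t (e : R), 0 <= e ->
    (forall s, dominated (fun f => mu f - translate t mu f) [set s + x | x in H] e) ->
    forall f, Cc f -> (forall x, normc (f x) <= 1) -> (forall x, ~ H x -> f x = 0) ->
    normc (eta f - translate t eta f) <= k * e.
Proof.
have [k k0 [dA dB]] := dominated_van_hove.
exists k => // H t e e0 dH f cf f1 fH.
have lrho := lb_tilde lnu.
(* [K] and [N] may depend on [g], hence on [t], because this bound disappears in the limit. *)
have bterm g : Cc g -> (forall x, normc (g x) <= 1) -> exists2 K, compact K &
    exists2 N, 0 <= N & forall n,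
    normc (boundary_term mu (tilde nu) (A n) g) <= k * b K n * N.
  move=> cg g1; pose L := closure [set x | g x != 0].
  have cL : compact L by case: cg.
  have [N N0 dN] := translation_bounded_dominated hG lcG lmu mu_bounded cL.
  have [K cK dK] := dB L cL; exists K => //; exists N => // n.
  rewrite -[N]mulr1; apply: boundary_term_le (dK n) => //.
  by move=> x; exact: Cc_supp.
pose ft := translate_fun (- t) f.
have cft : Cc ft by exact: Cc_translate.
have [K1 cK1 [N1 N10 bf]] := bterm f cf f1.
have [K2 cK2 [N2 N20 bft]] := bterm ft cft (fun x => f1 _).
pose K0 := closure V.
(* The coefficient of [d]: 2 for the limits at [f] and [ft], [k * e] for the boundary in the packing
   bound, and [k * N1], [k * N2] for the two boundary terms. *)
have k1 : 0 <= 2 + k * e + k * N1 + k * N2 by rewrite !addr_ge0 ?mulr_ge0.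
apply: (le_eps_mul k1) => d d0.
pose u n g : R[i] := ((a n)%:C)^-1 *
  convolution (restriction mu (A n)) (restriction (tilde nu) [set - x | x in A n]) g.
have small K : compact K -> \forall n \near \oo, b K n <= d * a n.
  move=> cK; have [_ /(_ K cK)] := A_van_hove.
  move=> /cvgrPdist_lt/(_ d d0); apply: filterS => n.
  rewrite sub0r normrN ger0_norm; last by rewrite divr_ge0// ltW// a_gt0.
  by rewrite ltr_pdivrMr ?a_gt0// => /ltW.
have [n [] ] : exists n, [/\ b K0 n <= d * a n, b K1 n <= d * a n, b K2 n <= d * a n,
    normc (eta f - u n f) < d & normc (eta ft - u n ft) < d].
  apply: (@filter_ex _ \oo); near=> n; split; near: n; try exact: small.
  - by have /cvg_normcP/(_ d d0) := etaP cf.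
  - by have /cvg_normcP/(_ d d0) := etaP cft.
move=> b0 b1 b2 u1 u2.
have un : normc (u n f - u n ft) <= k * e + (k * e + k * N1 + k * N2) * d.
  rewrite /u -mulrBr Normc.normcM Normc.normcV normc_real gtr0_norm ?a_gt0//.
  rewrite mulrC ler_pdivrMr ?a_gt0// convolution_translate_diff//.
  rewrite (le_trans (normcB _ _))//.
  have lD : locally_bounded (fun f => mu f - translate t mu f).
    by apply: lb_sub => //; exact: lb_translate.
  have h1 := smoothed_le hG lcG lrho (oA n) (pA n) lD cf f1 fH e0 dH (dA n).
  have h2 : normc (boundary_term mu (tilde nu) (A n) f - boundary_term mu (tilde nu) (A n) ft) <=
      k * b K1 n * N1 + k * b K2 n * N2.
    by rewrite (le_trans (normcB _ _))// lerD.
  apply: (@le_trans _ _ (k * (a n + b K0 n) * e + (k * b K1 n * N1 + k * b K2 n * N2))).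
    by rewrite lerD.
  have h3 : k * b K0 n * e <= k * (d * a n) * e by rewrite ler_wpM2r// ler_wpM2l.
  have h4 : k * b K1 n * N1 <= k * (d * a n) * N1 by rewrite ler_wpM2r// ler_wpM2l.
  have h5 : k * b K2 n * N2 <= k * (d * a n) * N2 by rewrite ler_wpM2r// ler_wpM2l.
  lra.
rewrite /translate -/ft.
have -> : eta f - eta ft = (eta f - u n f) + (u n f - u n ft) - (eta ft - u n ft).
  by rewrite addrA subrK opprB addrA subrK.
rewrite (le_trans (normcB _ _))// (le_trans (lerD (le_normcD _ _) (lexx _)))//.
lra.
Unshelve. all: by end_near. Qed.

End Eberlein.

(** * Transfer of almost periods from [mu] to [eta] *)

Section Conclusion.
Variables (R : realType) (G : topologicalZmodType).

Lemma relatively_denseS (S S' : set G) : S `<=` S' -> relatively_dense S ->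
  relatively_dense S'.
Proof.
move=> SS' [K cK SK]; exists K => //; apply/seteqP; split => // x _.
have [s Ss [k Kk <-]] : [set s + k | s in S & k in K] x by rewrite SK.
by exists s; [exact: SS'|exists k].
Qed.

End Conclusion.

Theorem corollary4p29 (R : realType) (G : topologicalZmodType)
    (G_hausdorff : hausdorff_space G)
    (G_second_countable : @second_countable G)
    (G_locally_compact : locally_compact [set: G])
    (haar : {measure set (borel G) -> \bar R}) (haarP : haar_measure haar)
    (K : set G) (K_compact : compact K) (K_interior : K° !=set0)
    (mu nu : complex_radon R G)
    (mu_bounded : translation_bounded mu) (nu_bounded : translation_bounded nu)
    (A : nat -> set G) (A_van_hove : van_hove haar A)
    (eta : complex_radon R G) (etaP : is_twisted_eberlein haar A mu nu eta) :
  norm_almost_periodic K mu -> norm_almost_periodic K eta.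
Proof.
have lmu := lb_crm G_hausdorff mu.
have lnu := lb_crm G_hausdorff nu.
have leta := lb_crm G_hausdorff eta.
have [k k0 eta_le] := eberlein_translate_le G_hausdorff G_locally_compact haarP
  lmu lnu mu_bounded nu_bounded A_van_hove etaP.
(* Continuous functions approximating Borel pieces of [K] spill over into [H]; the constant [N] of
   [dominated_cover] leads back to the norm over [K]. *)
have [H cH KH] := compact_nbhs_of_compact G_locally_compact K_compact.
have [N dN] := dominated_cover R G_hausdorff K_compact K_interior cH.
move=> mu_ap e e0.
have kN : 0 < k * N%:R + 1 by rewrite ltr_wpDl// mulr_ge0.
(* The final bound is [k * (e' *+ N)]; the [+ 1] makes it strictly less than [e] and keeps the
   divisor positive. *)
pose e' := e / (k * N%:R + 1).
have e'0 : 0 < e' by rewrite divr_gt0.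
apply: relatively_denseS (mu_ap e' e'0) => t /= mu_t.
have lD (m : complex_radon R G) : locally_bounded (fun f => crm_integral m f - translate t m f).
  by apply: lb_sub; [exact: lb_crm|apply: lb_translate; exact: lb_crm].
have dH := dN _ _ (lD mu) (norm_on_dominated G_hausdorff (lD mu) K_compact (ltW mu_t)).
apply: (@le_lt_trans _ _ (k * (e' *+ N))%:E); last first.
  rewrite lte_fin -mulr_natr mulrCA mulrAC ltr_pdivrMr//.
  by rewrite ltr_pM2l// ltrDl.
apply: ge_ereal_sup => _ [s _ <-].
apply: (variation_le_Cc G_hausdorff G_locally_compact (lD eta) _
  (O := [set s + x | x in H°]) (H := [set s + x | x in H])).
- apply: regular_sub; first exact: regular_crm.
  by apply: regular_translate => //; exact: regular_crm.
- exact: compact_translate.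
- by apply: open_translate; exact: open_interior.
- by move=> _ [x Kx <-]; exists x => //; exact: KH.
- exact: compact_translate.
- by move=> _ [x Hx <-]; exists x => //; exact: interior_subset.
- move=> g cg g1 gH; apply: eta_le cg g1 gH; first by rewrite mulrn_wge0// ltW.
  move=> r; apply: dominatedS (dH (r + s)) => _ [_ [x Hx <-] <-].
  by exists x => //; rewrite addrA.
Qed.
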